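(* For every Noetherian space $X$ and every proper bound $\alpha$, the space $X^{<\alpha}$ with the regular subword topology satisfies $$\mathrm{rsob}\,(X^{<\alpha})\le \omega^{(||X||\oplus[\alpha])^\circ}\qquad\text{and}\qquad ||X^{<\alpha}||\le \omega^{\omega^{(||X||\oplus[\alpha])^\circ}}.$$
   Context: A topological space is Noetherian if every open subset is compact (no separation required); equivalently, its closed subsets are well-founded under inclusion. A closed set $C$ is irreducible if $C\neq\emptyset$ and whenever $C\subseteq F_1\cup F_2$ with $F_1,F_2$ closed, $C\subseteq F_1$ or $C\subseteq F_2$. $\mathcal S Z$ denotes the set of irreducible closed subsets of $Z$, ordered by inclusion. The rank of an element $x$ of a well-founded poset is the least ordinal strictly larger than the ranks of all $y<x$. For a Noetherian space $Z$, its stature $||Z||$ is the rank of $Z$ in the lattice of closed subsets of $Z$ ordered by inclusion. A non-empty Noetherian space $Z$ has finitely many maximal irreducible closed subsets $C_1,\dots,C_n$ ($n\ge1$); its reduced sobrification rank $\mathrm{rsob}\,Z$ is the maximum of the ranks of $C_1,\dots,C_n$ in $\mathcal S Z$. A transfinite word $w$ on $X$ is a map from an ordinal $|w|$ (its length) to $X$. For $F\subseteq X$ and an ordinal $\gamma$, $F^{<\gamma}$ is the set of transfinite words of length $<\gamma$ all of whose letters are in $F$. The concatenation $ww'$ has length $|w|+|w'|$, and $AB=\{ww'\mid w\in A,\ w'\in B\}$. The regular subword topology on $X^{<\alpha}$ is the coarsest topology making all the sets $(F_1^{<\alpha_1}\cdots F_n^{<\alpha_n})\cap X^{<\alpha}$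 closed, where $n\in\mathbb N$, $F_1,\dots,F_n$ are closed in $X$ and $\alpha_1,\dots,\alpha_n$ are ordinals. A proper bound is an ordinal of the form $\omega^\beta$ or $\omega^\beta+1$ with $\beta\ge1$. For a proper bound $\gamma$, $[\gamma]$ is the rank of $\gamma$ in the poset of all proper bounds less than or equal to $\gamma$; explicitly, for $n\in\mathbb N$ and $\lambda$ a limit ordinal, $[\omega^n]=2n-2$ and $[\omega^n+1]=2n-1$ if $n\ge1$, $[\omega^{\lambda+n}]=\lambda+2n$, and $[\omega^{\lambda+n}+1]=\lambda+2n+1$. $\oplus$ is the natural (Hessenberg) sum of ordinals. An ordinal $\delta$ is critical if $\omega^\delta=\delta$. For an ordinal $\alpha$, $\alpha^\circ$ is $\alpha+1$ if $\alpha=\delta+n$ for some critical ordinal $\delta$ and some $n\in\mathbb N$, and $\alpha$ otherwise. *)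

(* Defs.v *)
From Stdlib Require Import Wellfounded.Inverse_Image.
From HB Require Import structures.
From mathcomp Require Import all_boot all_order.
From mathcomp Require Import finmap boolp classical_sets topology.

Set Implicit Arguments.
Unset Strict Implicit.
Unset Printing Implicit Defensive.

Local Open Scope classical_set_scope.

(** * Ordinals *)

(** [ord_above f] is the least ordinal strictly above every [f i].  A given
    ordinal has many such presentations, so ordinals are compared with [ole],
    [olt] and [oeq], never with Leibniz equality. *)
Inductive ord := ord_above (I : Type) (f : I -> ord).

Fixpoint ole (a b : ord) {struct a} : Prop :=
  let: ord_above _ f := a in let: ord_above _ g := b in
  forall i, exists j, ole (f i) (g j).

Definition olt (a b : ord) : Prop :=
  let: ord_above _ g := b in exists j, ole a (g j).

Definition oeq (a b : ord) : Prop := ole a b /\ ole b a.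

Lemma ole_refl a : ole a a.
Proof. by elim: a => I f IH /= i; exists i. Qed.

Lemma ole_trans b a c : ole a b -> ole b c -> ole a c.
Proof.
elim: a b c => I f IH [J g] [K h] /= ab bc i.
have [j fg] := ab i; have [k gh] := bc j.
by exists k; apply: IH fg gh.
Qed.

Lemma olt_wf : well_founded olt.
Proof.
move=> a; suff: forall b, ole b a -> Acc olt b by apply; apply: ole_refl.
elim: a => I f IH [J g] /= ba; constructor => c /= [j cg].
have [i gf] := ba j; apply: (IH i); exact: ole_trans cg gf.
Qed.

Definition odom (a : ord) : Type := let: ord_above A _ := a in A.
Definition ochild (a : ord) : odom a -> ord :=
  match a return odom a -> ord with ord_above _ f => f end.

Definition osup (I : Type) (f : I -> ord) : ord :=
  ord_above (fun p : {i : I & odom (f i)} => ochild (projT2 p)).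

Definition omax (a b : ord) : ord := osup (fun c : bool => if c then a else b).

Definition ozero : ord := ord_above (fun i : void => match i with end).
Definition osucc (a : ord) : ord := ord_above (fun _ : unit => a).
Definition onat (n : nat) : ord := iter n osucc ozero.
Definition omega : ord := ord_above onat.

(** Writing [b] as [ord_above g], [b] is the supremum of the successors of the
    [g j]: the three recursions below are the usual ones, merging the zero,
    successor and limit cases. *)
Fixpoint oadd (a b : ord) {struct b} : ord :=
  let: ord_above _ g := b in omax a (ord_above (fun j => oadd a (g j))).

Fixpoint omul (a b : ord) {struct b} : ord :=
  let: ord_above _ g := b in osup (fun j => oadd (omul a (g j)) a).

(** Only meant for [a] at least one. *)
Fixpoint opow (a b : ord) {struct b} : ord :=
  let: ord_above _ g := b in
  omax (onat 1) (osup (fun j => omul (opow a (g j)) a)).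

(** The natural (Hessenberg) sum: [a (+) b] is the least ordinal strictly above
    all the [a' (+) b] with [a' < a] and all the [a (+) b'] with [b' < b]. *)
Fixpoint onadd (a : ord) : ord -> ord :=
  match a with
  | ord_above A f =>
    fix onadd_a (b : ord) : ord :=
      match b with
      | ord_above B g =>
        ord_above (fun k : A + B =>
          match k with inl i => onadd (f i) b | inr j => onadd_a (g j) end)
      end
  end.

Definition critical (d : ord) : Prop := oeq (opow omega d) d.

Definition ocirc (a : ord) : ord :=
  if `[< exists d n, critical d /\ oeq a (oadd d (onat n)) >]
  then osucc a else a.

Definition proper_bound (g : ord) : Prop :=
  exists b, ole (onat 1) b /\
    (oeq g (opow omega b) \/ oeq g (oadd (opow omega b) (onat 1))).

(** * Rank in a well-founded relation *)

Fixpoint rank_acc (T : Type) (R : T -> T -> Prop) (x : T) (Rx : Acc R x)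
    {struct Rx} : ord :=
  ord_above (fun y : {y | R y x} => rank_acc (Acc_inv Rx (svalP y))).

Definition rank (T : Type) (R : T -> T -> Prop) (Rwf : well_founded R) (x : T) :
    ord :=
  rank_acc (Rwf x).

(** * Well-orders

    They represent ordinals wherever the elements of the ordinal are needed:
    lengths of words, and the bound [alpha] in [X^{<alpha}]. *)

Record wellOrder := WellOrder {
  wo_sort :> Type;
  wo_lt : wo_sort -> wo_sort -> Prop;
  wo_wf : well_founded wo_lt;
  wo_trans : forall x y z, wo_lt x y -> wo_lt y z -> wo_lt x z;
  wo_total : forall x y, wo_lt x y \/ x = y \/ wo_lt y x }.

Definition otype (L : wellOrder) : ord := ord_above (rank (@wo_wf L)).

Section Segment.
Variables (L : wellOrder) (a : L).

Let seg : Type := {b : L | wo_lt b a}.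
Let seg_lt (x y : seg) : Prop := wo_lt (sval x) (sval y).

Let seg_wf : well_founded seg_lt.
Proof. exact: wf_inverse_image (@wo_wf L). Qed.

Let seg_trans x y z : seg_lt x y -> seg_lt y z -> seg_lt x z.
Proof. exact: wo_trans. Qed.

Let seg_total x y : seg_lt x y \/ x = y \/ seg_lt y x.
Proof.
case: x y => [x xa] [y ya]; rewrite /seg_lt /=.
case: (wo_total x y) => [|[xy|]]; [by left| |by right; right].
by right; left; case: y / xy ya => ya; congr exist; apply: Prop_irrelevance.
Qed.

Definition segment : wellOrder := WellOrder seg_wf seg_trans seg_total.

End Segment.

Section Sum.
Variables (L M : wellOrder).

Let sum_lt (x y : L + M) : Prop :=
  match x, y with
  | inl a, inl b => wo_lt a b
  | inl _, inr _ => True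
  | inr _, inl _ => False
  | inr a, inr b => wo_lt a b
  end.

Let sum_wf : well_founded sum_lt.
Proof.
have accl a : Acc sum_lt (inl a).
  elim: a / (wo_wf a) => a _ IH.
  by constructor; case=> b; [apply: IH|case].
case=> [a|a]; first exact: accl.
elim: a / (wo_wf a) => a _ IH.
by constructor; case=> b; [move=> _; apply: accl|apply: IH].
Qed.

Let sum_trans x y z : sum_lt x y -> sum_lt y z -> sum_lt x z.
Proof. by case: x y z => [a|a] [b|b] [c|c] //=; apply: wo_trans. Qed.

Let sum_total x y : sum_lt x y \/ x = y \/ sum_lt y x.
Proof.
case: x y => [a|a] [b|b] /=; [|by left|by right; right|].
- by case: (wo_total a b) => [|[->|]]; [left|right; left|right; right].
- by case: (wo_total a b) => [|[->|]]; [left|right; left|right; right].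
Qed.

Definition wo_sum : wellOrder := WellOrder sum_wf sum_trans sum_total.

End Sum.

(** For a well-order [L] whose order type is a proper bound, [bracket] is the
    rank of that bound in the poset of the proper bounds less than or equal to
    it.  The ordinals up to [otype L] are indexed by [option L]. *)

Definition below_otype (L : wellOrder) (x : option L) : ord :=
  if x is Some a then rank (@wo_wf L) a else otype L.

Definition proper_below (L : wellOrder) : Type :=
  {x : option L | proper_bound (below_otype x)}.

Definition proper_below_lt (L : wellOrder) (x y : proper_below L) : Prop :=
  olt (below_otype (sval x)) (below_otype (sval y)).

Lemma proper_below_wf (L : wellOrder) : well_founded (@proper_below_lt L).
Proof. exact: wf_inverse_image olt_wf. Qed.

Definition bracket (L : wellOrder) (hL : proper_bound (otype L)) : ord :=
  rank (@proper_below_wf L)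
    (exist (fun x => proper_bound (below_otype x)) None hL).

(** * Noetherian spaces *)

Definition noetherian (Z : topologicalType) : Prop :=
  forall U : set Z, open U -> compact U.

Definition closed_set (Z : topologicalType) : Type := {C : set Z | closed C}.

Definition closed_lt (Z : topologicalType) (C D : closed_set Z) : Prop :=
  sval C `<` sval D.

Definition irreducible_closed (Z : topologicalType) (C : set Z) : Prop :=
  [/\ closed C, C !=set0 &
    forall F1 F2 : set Z, closed F1 -> closed F2 ->
      C `<=` F1 `|` F2 -> C `<=` F1 \/ C `<=` F2].

Definition sobrification (Z : topologicalType) : Type :=
  {C : set Z | irreducible_closed C}.

Definition sober_lt (Z : topologicalType) (C D : sobrification Z) : Prop :=
  sval C `<` sval D.

Lemma noetherian_closed_wf (Z : topologicalType) :
  noetherian Z -> well_founded (@closed_lt Z).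
Proof.
move=> hZ C0; apply: contrapT => nC0.
pose T := {C : closed_set Z | ~ Acc (@closed_lt Z) C}.
have step (C : T) : exists D : T, closed_lt (sval D) (sval C).
  apply: contrapT => h; case: (svalP C); constructor => D DC.
  by apply: contrapT => nD; apply: h; exists (exist _ D nD).
have [g gP] := choice step.
pose c n : closed_set Z := sval (iter n g (exist _ C0 nC0)).
have cS n : closed_lt (c n.+1) (c n) by exact: (gP (iter n g (exist _ C0 nC0))).
have c_le m n : (m <= n)%N -> sval (c n) `<=` sval (c m).
  elim: n => [|n IH]; first by rewrite leqn0 => /eqP ->.
  rewrite leq_eqVlt => /orP[/eqP->//|/IH]; apply: subset_trans.
  exact: properW (cS n).
pose U := \bigcup_n ~` sval (c n).
have oc n : open (~` sval (c n)) by apply: closed_openC; apply: svalP.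
have oU : open U by apply: bigcup_open => n _; apply: oc.
pose F : set_system Z := [set A | exists n, U `&` sval (c n) `<=` A].
have FF : ProperFilter F.
  split.
    move=> [n Un]; have [_ /existsNP[x /not_implyP[xn xS]]] := cS n.
    by apply: (Un x); split=> //; exists n.+1.
  split; first by exists 0%N.
    move=> A B [m mA] [n nB]; exists (maxn m n) => x [Ux xc].
    by split; [apply: mA|apply: nB]; split=> //; apply: c_le xc;
      rewrite ?leq_maxl ?leq_maxr.
  by move=> A B AB [n nA]; exists n; apply: subset_trans nA AB.
have FU : F U by exists 0%N => x [].
have [x [[n _ xn] xF]] := hZ U oU F FF FU.
have [y [[_ yn] /(_ yn)//]] : (U `&` sval (c n)) `&` ~` sval (c n) !=set0.
by apply: xF; [exists n|exact: open_nbhs_nbhs].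
Qed.

Lemma noetherian_sober_wf (Z : topologicalType) :
  noetherian Z -> well_founded (@sober_lt Z).
Proof.
move=> hZ.
have h : well_founded (fun C D : sobrification Z =>
    closed_lt (exist _ (sval C) (let: And3 c _ _ := svalP C in c))
              (exist _ (sval D) (let: And3 c _ _ := svalP D in c))).
  exact: wf_inverse_image (noetherian_closed_wf hZ).
exact: h.
Qed.

Definition stature (Z : topologicalType) (hZ : noetherian Z) : ord :=
  rank (noetherian_closed_wf hZ) (exist _ setT closedT).

Definition sober_rank (Z : topologicalType) (hZ : noetherian Z)
    (C : sobrification Z) : ord :=
  rank (noetherian_sober_wf hZ) C.

(** When [Z] is non-empty there are finitely many maximal [C], and at least one,
    so that the supremum is a maximum. *)
Definition rsob (Z : topologicalType) (hZ : noetherian Z) : ord :=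
  osup (fun C : {C : sobrification Z | forall D, ~ sober_lt C D} =>
    sober_rank hZ (sval C)).

(** * Transfinite words *)

(** A length is a well-order rather than an ordinal, so that words only make
    sense up to [word_iso]. *)
Record word (X : Type) := Word { wlen : wellOrder; wletter : wlen -> X }.

Definition word_iso (X : Type) (u v : word X) : Prop :=
  exists f : wlen u -> wlen v,
    [/\ forall x y, wo_lt x y <-> wo_lt (f x) (f y),
        forall z, exists x, f x = z &
        forall x, wletter (f x) = wletter x].

Definition wcat (X : Type) (u v : word X) : word X :=
  Word (wlen := wo_sum (wlen u) (wlen v))
    (fun x => match x with inl i => wletter i | inr j => wletter j end).

(** The class of the words in [F_1^{<a_1} ... F_n^{<a_n}], where [s] lists the
    pairs [(F_i, a_i)]; the empty product contains just the empty word. *)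
Fixpoint word_product (X : topologicalType) (s : seq (closed_set X * ord))
    (w : word X) : Prop :=
  match s with
  | [::] => wlen w -> False
  | (F, a) :: s' => exists u v,
      [/\ olt (otype (wlen u)) a, forall x : wlen u, sval F (wletter x),
          word_product s' v & word_iso w (wcat u v)]
  end.

(** [X^{<alpha}], where [alpha] is the order type of [L]: the ordinals less than
    [alpha] are the initial segments of [L] determined by its elements. *)
Record words (X : Type) (L : wellOrder) := Words {
  words_len : L;
  words_letter : segment words_len -> X }.

Definition word_of (X : Type) (L : wellOrder) (w : words X L) : word X :=
  Word (@words_letter X L w).

Definition regular_subword_subbase (X : topologicalType) (L : wellOrder) :
    set (set (words X L)) :=
  [set U | exists s, U = ~` [set w | word_product s (word_of w)]].

HB.instance Definition _ (X : Type) (L : wellOrder) :=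
  gen_eqMixin (words X L).
HB.instance Definition _ (X : Type) (L : wellOrder) :=
  gen_choiceMixin (words X L).
HB.instance Definition _ (X : topologicalType) (L : wellOrder) :=
  isSubBaseTopological.Build (words X L) (@regular_subword_subbase X L) id.

(* Main.v *)
From Stdlib Require List.
Require Import Defs.
From mathcomp Require Import all_boot all_order.
From mathcomp Require Import finmap boolp classical_sets topology.

(** Call _atoms_ the sets [F^{<2}] and [F^{<g}] with [F] closed in [X] and [g] a
    proper bound at most [alpha].  Give [F^{<2}] the weight [||F||], give [F^{<g}]
    the weight [omega^((||F|| (+) [g])°)], and give a product of atoms the natural
    sum of their weights.  The key fact is that, for a product of atoms [P] and an
    arbitrary product [Q], either [P] is included in [Q] or [P /\ Q] is a finite
    union of products of atoms, each of them lighter than [P].  Weighing a finite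
    union of products by the natural sum of the [omega^weight], it follows that
    every closed set is such a union, lighter than every one that strictly
    contains it.  Hence [X^{<alpha}] is Noetherian and ranks of closed sets are
    bounded by weights; an irreducible closed set is a single product, and its rank
    among the irreducible closed sets is bounded by the weight of this product.
    The whole space is the single atom [X^{<alpha}]. *)

Set Implicit Arguments.
Unset Strict Implicit.
Unset Printing Implicit Defensive.

Local Open Scope classical_set_scope.

(** * Ordinal arithmetic *)

(** The weights are shaped by absorption. When [F^{<g}] meets a factor [G^{<b}] of [Q], a lighter
    atom [H^{<m}] can come in front of a product obtained earlier, and this can recur with each
    factor of [Q]. If that product still begins with [F^{<g}], the new atom is absorbed; if its head
    has already shrunk, the new atom adds up with it, so the weight of [F^{<g}] has to be closed
    under natural sums: hence a power of omega. The inequality of weights alone would be lost by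
    prepending an atom, whence the finer predicate [good], which records where the decrease took
    place. [F^{<2}] absorbs no nontrivial factor, so [||F||] is enough for it. As [F^{<g}] may
    shrink to [F^{<2}], its weight has to exceed [||F||]; but [a < omega^a] fails for critical [a],
    and [°] repairs this. The natural sum [||F|| (+) [g]] is strictly increasing in both arguments,
    so that shrinking either [F] or [g] pays. Bounds other than 2 and the proper ones can be
    removed, since [F^{<omega^e + c}] is [F^{<omega^e + 1} F^{<c}] for [c > 0]. *)

Lemma ole_aboveP I (f : I -> ord) b :
  ole (ord_above f) b <-> forall i, olt (f i) b.
Proof. by case: b. Qed.

Lemma ole_olt_trans b a c : ole a b -> olt b c -> olt a c.
Proof. by case: c => K h ab /= [k bk]; exists k; apply: ole_trans ab bk. Qed.

Lemma olt_ole_trans b a c : olt a b -> ole b c -> olt a c.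
Proof.
case: b c => J g [K h] /= [j aj] /(_ j) [k jk].
by exists k; apply: ole_trans aj jk.
Qed.

Lemma oltW a b : olt a b -> ole a b.
Proof.
elim: a b => I f IH b ab; apply/ole_aboveP => i.
case: b ab => J g /= [j /ole_aboveP/(_ i) /IH fg]; by exists j.
Qed.

Lemma olt_trans b a c : olt a b -> olt b c -> olt a c.
Proof. by move=> ab /oltW; apply: olt_ole_trans. Qed.

Lemma olt_irr a : ~ olt a a.
Proof. by elim/(well_founded_ind olt_wf): a => a IH h; exact: (IH a h h). Qed.

Lemma ole_or_olt a b : ole a b \/ olt b a.
Proof.
elim: a b => I f IH b; case: (pselect (forall i, olt (f i) b)) => h.
  by left; apply/ole_aboveP.
right; move/existsNP: h => [i fi]; exists i.
elim: b fi => J g IHb fi; apply/ole_aboveP => j.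
by case: (IH i (g j)) => // ij; case: fi; exists j.
Qed.

Lemma ole_oltN a b : ole a b -> ~ olt b a.
Proof. by move=> ab ba; apply: (@olt_irr a); apply: ole_olt_trans ab ba. Qed.

Lemma oltNge a b : ~ ole a b -> olt b a.
Proof. by case: (ole_or_olt a b). Qed.

Lemma oleNgt a b : ~ olt b a -> ole a b.
Proof. by case: (ole_or_olt a b). Qed.

Lemma oleP a b : ole a b <-> forall c, olt c a -> olt c b.
Proof.
split=> [ab c ca|h]; first exact: olt_ole_trans ca ab.
by apply: oleNgt => /h /olt_irr.
Qed.

Lemma oeq_refl a : oeq a a.
Proof. by split; apply: ole_refl. Qed.

Lemma oeq_sym a b : oeq a b -> oeq b a.
Proof. by case. Qed.

Lemma oeq_trans b a c : oeq a b -> oeq b c -> oeq a c.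
Proof.
by case=> ab ba [bc cb]; split; [apply: ole_trans ab bc|apply: ole_trans cb ba].
Qed.

Lemma ole0 a : ole ozero a.
Proof. by apply/ole_aboveP => -[]. Qed.

Lemma olt0 a : ~ olt a ozero.
Proof. by case=> -[]. Qed.

Lemma olt_succ a b : olt a (osucc b) <-> ole a b.
Proof. by split=> [[]|ab]; last exists tt. Qed.

Lemma ole_succ a b : ole (osucc a) b <-> olt a b.
Proof. by split=> [/ole_aboveP/(_ tt)|ab]; last by apply/ole_aboveP. Qed.

Lemma olt_succ_diag a : olt a (osucc a).
Proof. exact/olt_succ/ole_refl. Qed.

Lemma ole1 a : ole (onat 1) a <-> olt ozero a.
Proof. exact: ole_succ. Qed.

Lemma ole_osup I (f : I -> ord) b : ole (osup f) b <-> forall i, ole (f i) b.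
Proof.
split=> [h i|h]; last first.
  apply/ole_aboveP => -[i x] /=; move: x (h i).
  by case: (f i) => A g x /ole_aboveP; apply.
apply: ole_trans h; rewrite /osup.
case E : (f i) => [A g] /=; move=> x.
have: exists p : {i : I & odom (f i)}, ochild (projT2 p) = g x.
  move: x; rewrite -/(odom (ord_above g)).
  have -> : g = @ochild (ord_above g) by [].
  by rewrite -E => x; exists (existT _ i x).
by move=> [p <-]; exists p; apply: ole_refl.
Qed.

Lemma olt_osup I (f : I -> ord) a : olt a (osup f) <-> exists i, olt a (f i).
Proof.
split=> [[[i x]] /= ax|[i ai]].
  by exists i; move: x ax; case: (f i) => A g x; exists x.
by apply: olt_ole_trans ai _; move/ole_osup: (ole_refl (osup f)).
Qed.

Lemma ole_omax a b c : ole (omax a b) c <-> ole a c /\ ole b c.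
Proof.
rewrite /omax ole_osup; split=> [h|[ac bc] []//].
by split; [apply: (h true)|apply: (h false)].
Qed.

Lemma olt_omax a b c : olt c (omax a b) <-> olt c a \/ olt c b.
Proof.
rewrite /omax olt_osup; split=> [[[] h]|[h|h]]; first [by left|by right|idtac].
  by exists true.
by exists false.
Qed.

(** * Addition and left subtraction of ordinals *)

Lemma ole_add_above a J (g : J -> ord) c :
  ole (oadd a (ord_above g)) c <->
  ole a c /\ forall j, olt (oadd a (g j)) c.
Proof. by rewrite [oadd _ _]/= ole_omax ole_aboveP. Qed.

Lemma oadd_mono a a' b b' : ole a a' -> ole b b' -> ole (oadd a b) (oadd a' b').
Proof.
move=> aa'; elim: b b' => J g IH [J' g'] bb'; apply/ole_add_above; split.
  apply/(ole_trans aa').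
  by move/ole_add_above: (ole_refl (oadd a' (ord_above g'))) => [].
move=> j; have [j' jj'] := bb' j.
apply: ole_olt_trans (IH j _ jj') _.
by move/ole_add_above: (ole_refl (oadd a' (ord_above g'))) => [].
Qed.

Lemma ole_addr a b : ole a (oadd a b).
Proof.
by case: b => J g; move/ole_add_above: (ole_refl (oadd a (ord_above g))) => [].
Qed.

Lemma oadd_ltr a b b' : olt b b' -> olt (oadd a b) (oadd a b').
Proof.
case: b' => J g [j bj]; apply: ole_olt_trans (oadd_mono (ole_refl a) bj) _.
by move/ole_add_above: (ole_refl (oadd a (ord_above g))) => [].
Qed.

Lemma olt_add a b c :
  olt c (oadd a b) -> olt c a \/ exists2 b', olt b' b & ole c (oadd a b').
Proof.
case: b => J g; rewrite [oadd _ _]/= olt_omax => -[ca|]; first by left.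
by case=> j cj; right; exists (g j) => //; exists j; apply: ole_refl.
Qed.

Lemma ole_add a b c : ole a c -> (forall b', olt b' b -> olt (oadd a b') c) ->
  ole (oadd a b) c.
Proof.
case: b => J g ac h; apply/ole_add_above; split=> // j.
by apply: h; exists j; apply: ole_refl.
Qed.

Lemma oadd_ltrI a b b' : olt (oadd a b) (oadd a b') -> olt b b'.
Proof.
move=> h; apply: oltNge => b'b.
by apply: ole_oltN h; apply: oadd_mono => //; apply: ole_refl.
Qed.

Lemma oadd0 a : oeq (oadd a ozero) a.
Proof.
split; last exact: ole_addr.
by apply: ole_add; [apply: ole_refl|move=> b' /olt0].
Qed.

Lemma oadd_succ a b : oeq (oadd a (osucc b)) (osucc (oadd a b)).
Proof.
split; last by apply/ole_succ/oadd_ltr/olt_succ_diag.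
apply: ole_add; first by apply: oltW; apply/olt_succ/ole_addr.
by move=> b' /olt_succ b'b; apply/olt_succ/oadd_mono => //; apply: ole_refl.
Qed.

Lemma oadd1 a : oeq (oadd a (onat 1)) (osucc a).
Proof.
apply: oeq_trans (oadd_succ a ozero) _; have [h1 h2] := oadd0 a.
by split; apply/ole_succ/olt_succ.
Qed.

Lemma ole_addl a b : ole b (oadd a b).
Proof.
elim: b => J g IH; apply/ole_aboveP => j; apply: ole_olt_trans (IH j) _.
by apply: oadd_ltr; exists j; apply: ole_refl.
Qed.

(** What remains of [b] after an initial [a]; meaningful when [a] is at most [b]. Children of [b]
    below [a] lie inside the removed part and are dropped. *)
Fixpoint osub (a b : ord) {struct b} : ord :=
  let: ord_above J g := b in
  ord_above (fun j : {j : J | ole a (g j)} => osub a (g (sval j))).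

Lemma oadd_osub a b : ole a b -> oeq b (oadd a (osub a b)).
Proof.
elim: b => J g IH ab; split.
  apply/ole_aboveP => j; case: (ole_or_olt a (g j)) => aj.
    have [h _] := IH j aj; apply: ole_olt_trans h _; apply: oadd_ltr.
    by exists (exist _ j aj); apply: ole_refl.
  by apply: olt_ole_trans aj _; apply: ole_addr.
apply/ole_add_above; split=> // -[j aj] /=.
by exists j; have [] := IH j aj.
Qed.

(** * Finite multiples and powers of omega *)

Lemma omul_succ a b : oeq (omul a (osucc b)) (oadd (omul a b) a).
Proof.
rewrite [omul _ _]/=; split; first by apply/ole_osup => _; apply: ole_refl.
by move/ole_osup: (ole_refl (osup (fun _ : unit => oadd (omul a b) a))); apply.
Qed.

Lemma omul0 a : ole (omul a ozero) ozero.
Proof. by apply/ole_osup => -[]. Qed.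

Lemma olt_mul_omega a c :
  olt c (omul a omega) <-> exists n, olt c (oadd (omul a (onat n)) a).
Proof. by rewrite [omul _ _]/= olt_osup. Qed.

Lemma omul_nat_mono a n m : (n <= m)%N -> ole (omul a (onat n)) (omul a (onat m)).
Proof.
elim: m => [|m IH]; first by rewrite leqn0 => /eqP ->; apply: ole_refl.
rewrite leq_eqVlt => /orP[/eqP->|/IH h]; first exact: ole_refl.
have [_ h'] := omul_succ a (onat m).
by apply: ole_trans h (ole_trans (ole_addr _ _) h').
Qed.

Lemma omul_nat_monol a b n : ole a b -> ole (omul a (onat n)) (omul b (onat n)).
Proof.
move=> ab; elim: n => [|n IH].
  exact: (ole_trans (@omul0 a) (ole0 (omul b ozero))).
have [h _] := omul_succ a (onat n); have [_ h'] := omul_succ b (onat n).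
by apply: ole_trans h (ole_trans (oadd_mono IH ab) h').
Qed.

(* Division of [c] by [a] with remainder, except that [c] is only bounded above. *)
Lemma olt_mul_nat a n c : olt c (omul a (onat n)) ->
  exists n' r, [/\ (n' < n)%N, olt r a & ole c (oadd (omul a (onat n')) r)].
Proof.
elim: n => [|n IH]; first by move/olt_ole_trans/(_ (@omul0 a))/olt0.
have [h _] := omul_succ a (onat n); move=> /olt_ole_trans/(_ h)/olt_add[/IH|].
  by move=> [n' [r [nn ra cr]]]; exists n', r; split=> //; apply: leqW.
by move=> [r ra cr]; exists n, r.
Qed.

Local Notation opw := (opow omega).

Lemma opow_ge1 b : ole (onat 1) (opw b).
Proof. by case: b => J g; move/ole_omax: (ole_refl (opw (ord_above g))) => []. Qed.

Lemma opow_gt0 b : olt ozero (opw b).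
Proof. exact/ole1/opow_ge1. Qed.

Lemma olt_opow_above J (g : J -> ord) c :
  olt c (opw (ord_above g)) <->
  ole c ozero \/ exists j n, olt c (oadd (omul (opw (g j)) (onat n)) (opw (g j))).
Proof.
rewrite [opow _ _]/= olt_omax olt_osup olt_succ.
split=> -[h|[j]]; try by left.
  by move/olt_mul_omega => [n hn]; right; exists j, n.
by move=> [n hn]; right; exists j; apply/olt_mul_omega; exists n.
Qed.

Lemma opow_mono b b' : ole b b' -> ole (opw b) (opw b').
Proof.
elim: b b' => J g IH [J' g'] bb'; apply/oleP => c /olt_opow_above h.
apply/olt_opow_above; case: h => [|[j [n h]]]; [by left|right].
have [j' jj'] := bb' j; exists j', n; apply: olt_ole_trans h _.
by apply: oadd_mono; [apply: omul_nat_monol|]; apply: IH.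
Qed.

(** Frees [olt_opow_above] from the presentation of the exponent. *)
Lemma olt_opow b c : olt c (opw b) <->
  ole c ozero \/
  exists2 d, olt d b & exists n, olt c (oadd (omul (opw d) (onat n)) (opw d)).
Proof.
case: b => J g; rewrite olt_opow_above; split=> -[|]; try by left.
  by move=> [j h]; right; exists (g j) => //; exists j; apply: ole_refl.
move=> [d [j dj] [n h]]; right; exists j, n; apply: olt_ole_trans h _.
by apply: oadd_mono; [apply: omul_nat_monol|]; apply: opow_mono.
Qed.

Lemma opow_lt b b' : olt b b' -> olt (opw b) (opw b').
Proof.
move=> bb'; apply/olt_opow; right; exists b => //; exists 1%N.
have [_ h] := omul_succ (opw b) ozero.
apply: ole_olt_trans (ole_trans (ole_addl _ _) h) _.
apply: ole_olt_trans (oadd_ltr _ (opow_gt0 b)).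
by case: (oadd0 (omul (opw b) (osucc ozero))).
Qed.

Lemma ole_opow_self b : ole b (opw b).
Proof.
elim: b => J g IH; apply/ole_aboveP => j; apply: ole_olt_trans (IH j) _.
by apply: opow_lt; exists j; apply: ole_refl.
Qed.

(** * The natural sum *)

Lemma onadd_above I (f : I -> ord) J (g : J -> ord) c :
  ole (onadd (ord_above f) (ord_above g)) c <->
  (forall i, olt (onadd (f i) (ord_above g)) c) /\
  (forall j, olt (onadd (ord_above f) (g j)) c).
Proof.
rewrite [onadd _ _]/= ole_aboveP; split=> [h|[h1 h2] []//].
by split=> k; [apply: (h (inl k))|apply: (h (inr k))].
Qed.

Lemma onadd_mono a a' b b' : ole a a' -> ole b b' ->
  ole (onadd a b) (onadd a' b').
Proof.
elim: a a' b b' => I f IHa [I' f'] b b' aa'; elim: b b' => J g IHb [J' g'] bb'.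
have [h1 h2] := (onadd_above f' g' _).1 (ole_refl _).
apply/onadd_above; split=> [i|j].
  by have [i' ii'] := aa' i; apply: ole_olt_trans (h1 i'); apply: IHa.
by have [j' jj'] := bb' j; apply: ole_olt_trans (h2 j'); apply: IHb.
Qed.

Lemma onadd_ltl a a' b : olt a a' -> olt (onadd a b) (onadd a' b).
Proof.
case: a' b => I f [J g] [i ai].
apply: ole_olt_trans (onadd_mono ai (ole_refl _)) _.
by have [h _] := (onadd_above f g _).1 (ole_refl _).
Qed.

Lemma onadd_ltr a b b' : olt b b' -> olt (onadd a b) (onadd a b').
Proof.
case: b' a => J g [I f] [j bj].
apply: ole_olt_trans (onadd_mono (ole_refl _) bj) _.
by have [_ h] := (onadd_above f g _).1 (ole_refl _).
Qed.

Lemma ole_onadd a b c :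
  (forall a', olt a' a -> olt (onadd a' b) c) ->
  (forall b', olt b' b -> olt (onadd a b') c) -> ole (onadd a b) c.
Proof.
case: a b => I f [J g] h1 h2; apply/onadd_above.
by split=> k; [apply: h1|apply: h2]; exists k; apply: ole_refl.
Qed.

Lemma olt_onadd a b c : olt c (onadd a b) ->
  (exists2 a', olt a' a & ole c (onadd a' b)) \/
  (exists2 b', olt b' b & ole c (onadd a b')).
Proof.
case: a b => I f [J g] [[i|j] h]; [left; exists (f i)|right; exists (g j)];
  by [exists i; apply: ole_refl|exists j; apply: ole_refl|].
Qed.

Lemma onadd_lt a a' b b' : olt a a' -> ole b b' -> olt (onadd a b) (onadd a' b').
Proof.
by move=> /onadd_ltl h bb'; apply: olt_ole_trans (h _) (onadd_mono (ole_refl _) bb').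
Qed.

Lemma onaddA_le a b c : ole (onadd a (onadd b c)) (onadd (onadd a b) c).
Proof.
elim/(well_founded_ind olt_wf): a b c => a IHa b.
elim/(well_founded_ind olt_wf): b => b IHb c.
elim/(well_founded_ind olt_wf): c => c IHc.
apply: ole_onadd => [a' aa|d /olt_onadd[[b' bb]|[c' cc]] dh].
- apply: ole_olt_trans (IHa _ aa _ _) _; exact/onadd_ltl/onadd_ltl.
- apply: ole_olt_trans (onadd_mono (ole_refl _) dh) _.
  by apply: ole_olt_trans (IHb _ bb _) _; apply/onadd_ltl/onadd_ltr.
- apply: ole_olt_trans (onadd_mono (ole_refl _) dh) _.
  by apply: ole_olt_trans (IHc _ cc) _; apply: onadd_ltr.
Qed.

Lemma onadd0l_le b : ole (onadd ozero b) b.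
Proof.
elim/(well_founded_ind olt_wf): b => b IH.
by apply: ole_onadd => [a' /olt0//|b' bb]; apply: ole_olt_trans (IH _ bb) bb.
Qed.

Lemma onadd0r_le a : ole (onadd a ozero) a.
Proof.
elim/(well_founded_ind olt_wf): a => a IH.
by apply: ole_onadd => [b' bb|a' /olt0//]; apply: ole_olt_trans (IH _ bb) bb.
Qed.

Lemma ole_onaddr a b : ole a (onadd a b).
Proof.
elim: a => I f IH; apply/ole_aboveP => i; apply: ole_olt_trans (IH i) _.
by apply: onadd_ltl; exists i; apply: ole_refl.
Qed.

Lemma ole_onaddl a b : ole b (onadd a b).
Proof.
elim: b => I f IH; apply/ole_aboveP => i; apply: ole_olt_trans (IH i) _.
by apply: onadd_ltr; exists i; apply: ole_refl.
Qed.

Lemma oadd_le_onadd a b : ole (oadd a b) (onadd a b).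
Proof.
elim/(well_founded_ind olt_wf): b => b IH; apply: ole_add => [|b' bb].
  exact: ole_onaddr.
by apply: ole_olt_trans (IH _ bb) _; apply: onadd_ltr.
Qed.

(** Multiples of [d] and remainders can be added separately when [d] is closed under natural sums. A
    smaller [x] either has a smaller remainder, or loses a copy of [d], and that copy makes up for
    any new remainder because the sum of the remainders stays below [d]; likewise for [y]. Upper
    bounds instead of equalities keep the induction going. *)
Lemma onadd_mul_le d n m r s x y :
  (forall r s, olt r d -> olt s d -> olt (onadd r s) d) ->
  olt r d -> olt s d ->
  ole x (oadd (omul d (onat n)) r) -> ole y (oadd (omul d (onat m)) s) ->
  ole (onadd x y) (oadd (omul d (onat (n + m))) (onadd r s)).
Proof.
move=> dP.
have below k l e : (k < l)%N -> olt e d ->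
    olt (oadd (omul d (onat k)) e) (omul d (onat l)).
  move=> kl ed; have [_ h] := omul_succ d (onat k).
  apply: olt_ole_trans (ole_trans h (omul_nat_mono d kl)); exact: oadd_ltr.
elim/(well_founded_ind olt_wf): x n m r s y => x IHx n m r s y.
elim/(well_founded_ind olt_wf): y n m r s => y IHy n m r s rd sd xh yh.
apply: ole_onadd => [x' xx'|y' yy'].
  have /olt_add[/olt_mul_nat[n' [r' [nn rd' h]]]|[r' rr' h]] :=
    olt_ole_trans xx' xh.
    apply: ole_olt_trans (IHx _ xx' _ _ _ _ _ rd' sd h yh) _.
    apply: olt_ole_trans (ole_addr _ _); apply: below; last exact: dP.
    by rewrite ltn_add2r.
  apply: ole_olt_trans (IHx _ xx' _ _ _ _ _ (olt_trans rr' rd) sd h yh) _.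
  exact/oadd_ltr/onadd_ltl.
have /olt_add[/olt_mul_nat[n' [r' [nn rd' h]]]|[r' rr' h]] :=
  olt_ole_trans yy' yh.
  apply: ole_olt_trans (IHy _ yy' _ _ _ _ rd rd' xh h) _.
  apply: olt_ole_trans (ole_addr _ _); apply: below; last exact: dP.
  by rewrite ltn_add2l.
apply: ole_olt_trans (IHy _ yy' _ _ _ _ rd (olt_trans rr' sd) xh h) _.
exact/oadd_ltr/onadd_ltr.
Qed.

(** By induction on the exponent: [x] and [y] are below finite multiples of one power [omega^c] with
    [c < b], which is itself closed under natural sums, so [onadd_mul_le] applies with
    [d = omega^c]. *)
Lemma opow_onadd b x y :
  olt x (opw b) -> olt y (opw b) -> olt (onadd x y) (opw b).
Proof.
elim/(well_founded_ind olt_wf): b x y => b IH x y xb yb.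
case/olt_opow: (xb) => [x0|[d db [n xd]]].
  by apply: ole_olt_trans (ole_trans (onadd_mono x0 (ole_refl y)) (onadd0l_le y)) yb.
case/olt_opow: (yb) => [y0|[e eb [m ye]]].
  by apply: ole_olt_trans (ole_trans (onadd_mono (ole_refl x) y0) (onadd0r_le x)) xb.
have [c [cb dc ec]] : exists c, [/\ olt c b, ole d c & ole e c].
  case: (ole_or_olt d e) => [de|/oltW ed].
    by exists e; split=> //; apply: ole_refl.
  by exists d; split=> //; apply: ole_refl.
have up z u k : ole u c ->
    olt z (oadd (omul (opw u) (onat k)) (opw u)) ->
    exists k' r, olt r (opw c) /\ ole z (oadd (omul (opw c) (onat k')) r).
  move=> uc h; have [_ hs] := omul_succ (opw c) (onat k).
  have /olt_mul_nat[k' [r [_ rc zh]]] : olt z (omul (opw c) (onat k.+1)).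
    apply: olt_ole_trans (olt_ole_trans h _) hs.
    by apply: oadd_mono; [apply: omul_nat_monol|]; apply: opow_mono.
  by exists k', r.
have [n' [r [rc xh]]] := up _ _ _ dc xd.
have [m' [s [sc yh]]] := up _ _ _ ec ye.
apply/olt_opow; right; exists c => //; exists (n' + m')%N.
apply: ole_olt_trans (onadd_mul_le (IH _ cb) rc sc xh yh) _.
exact/oadd_ltr/IH.
Qed.

Lemma opow_oadd b x y :
  olt x (opw b) -> olt y (opw b) -> olt (oadd x y) (opw b).
Proof.
move=> xb yb; exact: ole_olt_trans (oadd_le_onadd x y) (opow_onadd xb yb).
Qed.

Lemma opow_oadd_le b x y :
  olt x (opw b) -> ole y (opw b) -> ole (oadd x y) (opw b).
Proof.
move=> xb yb; apply: ole_add; first exact: oltW.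
by move=> y' yy'; apply: opow_oadd => //; apply: olt_ole_trans yy' yb.
Qed.

Lemma oeq_succ a b : oeq a b -> oeq (osucc a) (osucc b).
Proof. by case=> ab ba; split; apply/ole_succ/olt_succ. Qed.

(** * The operation [ocirc] *)

Lemma ocirc_ge a : ole a (ocirc a).
Proof.
by rewrite /ocirc; case: ifP => _; [apply/oltW/olt_succ_diag|apply: ole_refl].
Qed.

(** The only danger is that [a] gets a successor and [b] does not. If [a] is a critical ordinal plus
    [n] and [b] is at most [a + 1], then [b] is the same critical ordinal plus [n + 1], so [b] gets
    its successor as well. *)
Lemma ocirc_lt a b : olt a b -> olt (ocirc a) (ocirc b).
Proof.
move=> ab; rewrite {1}/ocirc; case: ifP => [/asboolP[d [n [dc [h1 h2]]]]|_]; last first.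
  exact: olt_ole_trans ab (ocirc_ge b).
rewrite /ocirc; case: ifP => [_|/negbT/asboolPn nb].
  exact/olt_succ/ole_succ.
apply: oltNge => ba; apply: nb; exists d, n.+1; split=> //.
have [s1 s2] := oeq_trans (oeq_succ (conj h1 h2)) (oeq_sym (oadd_succ d (onat n))).
split; first exact: ole_trans ba s1.
by apply: ole_trans s2 _; apply/ole_succ.
Qed.

(* This is what [ocirc] is for: [a < omega^a] fails when [a] is critical. *)
Lemma olt_opow_ocirc a : olt a (opw (ocirc a)).
Proof.
rewrite /ocirc; case: ifP => [_|/negbT/asboolPn na].
  by apply: ole_olt_trans (ole_opow_self a) (opow_lt (olt_succ_diag a)).
apply: oltNge => h; apply: na; exists a, 0%N; split; last exact/oeq_sym/oadd0.
by split=> //; apply: ole_opow_self.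
Qed.

(** * Ranks and order types of subsets *)

Section Rank.
Variables (T : Type) (R : T -> T -> Prop) (Rwf : well_founded R).

Lemma rank_accE x (Rx : Acc R x) :
  rank_acc Rx = ord_above (fun y : {y | R y x} => rank Rwf (sval y)).
Proof.
case: Rx => h /=; congr ord_above; apply: funext => y.
congr rank_acc; exact: Prop_irrelevance.
Qed.

Lemma rank_le x b : ole (rank Rwf x) b <-> forall y, R y x -> olt (rank Rwf y) b.
Proof.
rewrite {1}/rank rank_accE ole_aboveP; split=> [h y yx|h [y yx]]; last exact: h.
exact: (h (exist _ y yx)).
Qed.

Lemma rank_lt y x : R y x -> olt (rank Rwf y) (rank Rwf x).
Proof. by move=> yx; apply: (rank_le x _).1 yx; apply: ole_refl. Qed.

Lemma rank_ltP x b : olt b (rank Rwf x) <-> exists2 y, R y x & ole b (rank Rwf y).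
Proof.
rewrite {1}/rank rank_accE; split=> [[[y yx] /= h]|[y yx h]]; first by exists y.
by exists (exist _ y yx).
Qed.

(** Go down from [x] while the rank exceeds [b]; transitivity makes the element reached a
    predecessor of [x] itself. *)
Lemma rank_surj x b : (forall x y z, R x y -> R y z -> R x z) ->
  olt b (rank Rwf x) -> exists2 y, R y x & oeq b (rank Rwf y).
Proof.
move=> tr; elim/(well_founded_ind Rwf): x => x IH /rank_ltP[y yx h].
case: (ole_or_olt (rank Rwf y) b) => [yb|/(IH _ yx)[z zy zb]]; first by exists y.
by exists z => //; apply: tr yx.
Qed.

Lemma rank_sub x y : (forall z, R z x -> R z y) -> ole (rank Rwf x) (rank Rwf y).
Proof. by move=> h; apply/rank_le => z /h/rank_lt. Qed.

End Rank.

(** * Order types of sets of positions, and their initial segments *)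

Section Subsets.
Variable T : wellOrder.
Implicit Types (S D : set T) (x y : T).

Lemma relin_wf S : well_founded (fun y x => S y /\ wo_lt y x).
Proof.
move=> x; elim/(well_founded_ind (@wo_wf T)): x => x IH.
by constructor=> y [_ /IH].
Qed.

(* The order type of the elements of [S] below [x], which need not be in [S]. *)
Definition pos S x : ord := rank (@relin_wf S) x.

Definition tp S : ord := ord_above (fun y : {y | S y} => pos S (sval y)).

Lemma pos_le S x b :
  ole (pos S x) b <-> forall y, S y -> wo_lt y x -> olt (pos S y) b.
Proof.
by rewrite /pos rank_le; split=> h y; [move=> Sy yx; apply: h|case; apply: h].
Qed.

Lemma pos_lt S y x : S y -> wo_lt y x -> olt (pos S y) (pos S x).
Proof. by move=> Sy yx; apply: (pos_le S x _).1 Sy yx; apply: ole_refl. Qed.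

Lemma tp_le S b : ole (tp S) b <-> forall y, S y -> olt (pos S y) b.
Proof.
rewrite /tp ole_aboveP; split=> [h y Sy|h [y Sy]]; last exact: h.
exact: (h (exist _ y Sy)).
Qed.

Lemma tp_lt S y : S y -> olt (pos S y) (tp S).
Proof. by apply: (tp_le S _).1; apply: ole_refl. Qed.

Lemma olt_tp S b : olt b (tp S) -> exists2 y, S y & ole b (pos S y).
Proof. by move=> [[y Sy] h]; exists y. Qed.

Lemma olt_pos S b x : olt b (pos S x) ->
  exists y, [/\ S y, wo_lt y x & ole b (pos S y)].
Proof. by move/rank_ltP => [y [Sy yx] h]; exists y. Qed.

Lemma pos_mono S S' x : S `<=` S' -> ole (pos S x) (pos S' x).
Proof.
move=> SS; elim/(well_founded_ind (@wo_wf T)): x => x IH.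
apply/pos_le => y Sy yx; apply: ole_olt_trans (IH y yx) _.
by apply: pos_lt => //; apply: SS.
Qed.

Lemma tp_mono S S' : S `<=` S' -> ole (tp S) (tp S').
Proof.
move=> SS; apply/tp_le => y Sy; apply: ole_olt_trans (pos_mono y SS) _.
exact/tp_lt/SS.
Qed.

Lemma tp_empty S : (forall x, ~ S x) -> ole (tp S) ozero.
Proof. by move=> S0; apply/tp_le => y /S0. Qed.

Lemma tp_gt0 S x : S x -> olt ozero (tp S).
Proof. by move=> Sx; apply: ole_olt_trans (tp_lt Sx); apply: ole0. Qed.

Definition down D S := D `<=` S /\ forall x y, D x -> S y -> wo_lt y x -> D y.

Lemma down_total D1 D2 S : down D1 S -> down D2 S -> D1 `<=` D2 \/ D2 `<=` D1.
Proof.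
move=> [s1 d1] [s2 d2]; case: (pselect (D1 `<=` D2)) => h; [by left|right].
move/existsNP: h => [x /not_implyP[x1 x2]] y y2.
case: (wo_total x y) => [xy|[xy|yx]].
- by case: x2; apply: d2 y2 (s1 _ x1) xy.
- by rewrite -xy.
- by apply: d1 x1 (s2 _ y2) yx.
Qed.

Lemma down_lt D S x y : down D S -> D x -> S y -> ~ D y -> wo_lt x y.
Proof.
move=> [_ d] Dx Sy nDy; case: (wo_total x y) => [//|[xy|yx]].
  by case: nDy; rewrite -xy.
by case: nDy; apply: d Dx Sy yx.
Qed.

Lemma down_sub D1 D2 S : D1 `<=` D2 -> down D1 S -> down D2 S -> down D1 D2.
Proof. by move=> s12 [_ h] [s2 _]; split=> // x y Dx /s2; apply: h. Qed.

Lemma down_setI D S S' : S' `<=` S -> down D S -> down (D `&` S') S'.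
Proof.
move=> SS [_ d]; split=> [x []//|x y [Dx _] Sy yx]; split=> //.
by apply: d Dx (SS _ Sy) yx.
Qed.

Lemma down_setD D1 D2 S : down D1 S -> down D2 S -> down (D2 `\` D1) (S `\` D1).
Proof.
move=> _ [s d]; split=> [x [/s Sx nx]//|x y [Dx _] [Sy ny] yx]; split=> //.
exact: d Dx Sy yx.
Qed.

Lemma down_setU D D' S : down D S -> down D' (S `\` D) -> down (D `|` D') S.
Proof.
move=> dD [s' d']; have [s d] := dD; split=> [x [/s//|/s'[]//]|x y [Dx|Dx] Sy yx].
  by left; apply: d Dx Sy yx.
by case: (pselect (D y)) => Dy; [left|right; apply: d' Dx _ yx].
Qed.

Lemma down0 S : down set0 S.
Proof. by split=> [x []|x y []]. Qed.

Lemma pos_down D S x : down D S -> D x -> ole (pos S x) (pos D x).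
Proof.
move=> [s d]; elim/(well_founded_ind (@wo_wf T)): x => x IH Dx.
apply/pos_le => y Sy yx; have Dy := d _ _ Dx Sy yx.
exact: ole_olt_trans (IH y yx Dy) (pos_lt Dy yx).
Qed.

Lemma tp_le_pos D S x : down D S -> S x -> ~ D x -> ole (tp D) (pos S x).
Proof.
move=> dD Sx nDx; apply/tp_le => y Dy.
apply: ole_olt_trans (pos_mono y (proj1 dD)) _.
by apply: pos_lt; [apply: (proj1 dD)|apply: down_lt dD Dy Sx nDx].
Qed.

Lemma tp_down_lt D S x : down D S -> S x -> ~ D x -> olt (tp D) (tp S).
Proof. by move=> dD Sx nDx; apply: ole_olt_trans (tp_le_pos dD Sx nDx) (tp_lt Sx). Qed.

Lemma pos_setD D S x : down D S -> S x -> ~ D x ->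
  oeq (pos S x) (oadd (tp D) (pos (S `\` D) x)).
Proof.
move=> dD; elim/(well_founded_ind (@wo_wf T)): x => x IH Sx nDx; split.
  apply/pos_le => y Sy yx; case: (pselect (D y)) => Dy.
    apply: olt_ole_trans (ole_addr _ _).
    by apply: ole_olt_trans (pos_down dD Dy) (tp_lt Dy).
  have [h _] := IH y yx Sy Dy; apply: ole_olt_trans h _.
  exact/oadd_ltr/pos_lt.
apply: ole_add => [|b /olt_pos[y [[Sy Dy] yx h]]]; first exact: tp_le_pos.
have [_ h'] := IH y yx Sy Dy.
apply: ole_olt_trans (oadd_mono (ole_refl _) h) _.
by apply: ole_olt_trans h' _; apply: pos_lt.
Qed.

Lemma tp_setD D S : down D S -> oeq (tp S) (oadd (tp D) (tp (S `\` D))).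
Proof.
move=> dD; split.
  apply/tp_le => y Sy; case: (pselect (D y)) => Dy.
    apply: olt_ole_trans (ole_addr _ _).
    by apply: ole_olt_trans (pos_down dD Dy) (tp_lt Dy).
  have [h _] := pos_setD dD Sy Dy; apply: ole_olt_trans h _.
  exact/oadd_ltr/tp_lt.
apply: ole_add => [|b /olt_tp[y [Sy Dy] h]]; first exact/tp_mono/(proj1 dD).
have [_ h'] := pos_setD dD Sy Dy.
apply: ole_olt_trans (oadd_mono (ole_refl _) h) _.
by apply: ole_olt_trans h' _; apply: tp_lt.
Qed.

Lemma down_pos S b : down [set x | S x /\ olt (pos S x) b] S.
Proof.
split=> [x []//|x y [Sx xb] Sy yx]; split=> //.
exact: olt_trans (pos_lt Sy yx) xb.
Qed.

Lemma tp_pos S b : ole (tp [set x | S x /\ olt (pos S x) b]) b.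
Proof.
apply/tp_le => y [Sy yb]; apply: ole_olt_trans yb.
by apply: pos_mono => x [].
Qed.

End Subsets.

(** * Products of sets of words *)

(** The condition on lengths that makes [F^{<m} G^{<b}] a part of [G^{<b}] when [F] is included in
    [G]; see [cut_absorb]. *)
Definition absorbs m b := forall u v, olt u m -> olt v b -> olt (oadd u v) b.

Section Cut.
Variables (X : Type) (w : word X).
Local Notation T := (wlen w).
Implicit Types (S D : set T) (F G : set X) (K L : set T -> Prop) (a b m : ord).

(* Factors of [w] are given by sets of positions of [w], so that no isomorphism
   of words is involved: [S] is in [F^{<a} K]. *)
Definition cut F a K S := exists D,
  [/\ down D S, olt (tp D) a, forall x, D x -> F (wletter x) & K (S `\` D)].

(** Closure under subwords. Products have it, which allows letters to be discarded from the
    remainder of a word. *)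
Definition hereditary K := forall S S', S' `<=` S -> K S -> K S'.

Lemma cut_mono F F' a a' K K' S : F `<=` F' -> ole a a' ->
  (forall S, K S -> K' S) -> cut F a K S -> cut F' a' K' S.
Proof.
move=> FF aa KK [D [d t l k]]; exists D; split=> //.
- exact: olt_ole_trans t aa.
- by move=> x /l/FF.
- exact: KK.
Qed.

Lemma cut_hered F a K : hereditary K -> hereditary (cut F a K).
Proof.
move=> hK S S' SS [D [d t l k]]; exists (D `&` S'); split.
- exact: down_setI SS d.
- by apply: ole_olt_trans t; apply: tp_mono => x [].
- by move=> x [Dx _]; apply: l.
- by apply: hK k => x [S'x /not_andP[]// nD]; split; [apply: SS|].
Qed.

Lemma cut_skip F a K S : hereditary K -> olt ozero a -> K S -> cut F a K S.
Proof.
move=> hK a0 k; exists set0; split=> //; first exact: down0.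
  by apply: ole_olt_trans a0; apply: tp_empty => x.
by apply: hK k => x [].
Qed.

Lemma cut_absorb F G m b K S : hereditary K -> F `<=` G -> absorbs m b ->
  cut F m (cut G b K) S -> cut G b K S.
Proof.
move=> hK FG mb [D [d t l [D' [d' t' l' k]]]]; exists (D `|` D'); split.
- exact: down_setU.
- have dDU : down D (D `|` D') by apply: down_sub d (down_setU d d') => x; left.
  have [h _] := tp_setD dDU; apply: ole_olt_trans h _.
  apply: ole_olt_trans (oadd_mono (ole_refl _) _) (mb _ _ t t').
  by apply: tp_mono => x [[]].
- by move=> x [/l/FG|/l'].
- by apply: hK k => x [Sx /not_orP[]].
Qed.

Section Inter.
Variables (F G : set X) (a b : ord) (K L : set T -> Prop).
Hypotheses (hK : hereditary K) (hL : hereditary L).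
Let A := cut F a K.
Let B := cut G b L.
Let H := F `&` G.

(** Both decompositions begin with an initial segment of the same [S], so one of these segments is
    included in the other. Removing the shorter one leaves a set that still lies in the whole
    product of the longer one. *)
Lemma cut_inter S : A S -> B S -> exists D1 D2,
  [/\ [/\ down D1 S, olt (tp D1) a, forall x, D1 x -> F (wletter x) & K (S `\` D1)],
      [/\ down D2 S, olt (tp D2) b, forall x, D2 x -> G (wletter x) & L (S `\` D2)] &
      (D1 `<=` D2 /\ B (S `\` D1)) \/ (D2 `<=` D1 /\ A (S `\` D2))].
Proof.
have aux (D1 D2 S' : set T) : D1 `<=` D2 -> S' `\` D1 `\` (D2 `\` D1) `<=` S' `\` D2.
  move=> _ x [[Sx n1] n2]; split=> // Dx; exact: n2.
move=> [D1 [d1 t1 l1 k1]] [D2 [d2 t2 l2 k2]]; exists D1, D2; split=> //.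
case: (down_total d1 d2) => s; [left|right]; split=> //.
  exists (D2 `\` D1); split.
  - exact: down_setD.
  - by apply: ole_olt_trans t2; apply: tp_mono => x [].
  - by move=> x [/l2].
  - by apply: hL k2; apply: aux.
exists (D1 `\` D2); split.
- exact: down_setD.
- by apply: ole_olt_trans t1; apply: tp_mono => x [].
- by move=> x [/l1].
- by apply: hK k1; apply: aux.
Qed.

(** Here [F^{<a}] can be removed from both sides while [G^{<b} L] stays whole: what is removed is
    absorbed back by [G^{<b}]. If the segment of [G^{<b}] is the shorter one, the remainder is in
    [L] and [G^{<b}] contributes the empty word. *)
Lemma cut_inter_absorb S : F `<=` G -> ole a b -> absorbs a b -> olt ozero b ->
  A S /\ B S <-> cut F a (fun S => K S /\ B S) S.
Proof.
move=> FG ab abs b0; split=> [[hA hB]|]; last first.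
  move=> h; split; first by move: h; apply: cut_mono => // [|S' []//]; apply: ole_refl.
  apply: (cut_absorb hL FG abs); move: h; apply: cut_mono => // [|S' []//].
  exact: ole_refl.
have [D1 [D2 [[d1 t1 l1 k1] [d2 t2 l2 k2] h]]] := cut_inter hA hB.
exists D1; split=> //; split=> //; case: h => [[]//|[s _]].
by apply: cut_skip => //; apply: hL k2 => x [Sx n1]; split=> // /s.
Qed.

(** Meant for [m] the minimum of [a] and [b]. The shorter of the two segments has its letters in [H]
    and its length below [m]; according to which one it is, the first factor of one side or of the
    other is used up. Conversely, the surviving factor absorbs [H^{<m}]. *)
Lemma cut_inter_limit m S : ole m a -> ole m b ->
  (forall u, olt u a -> olt u b -> olt u m) -> absorbs m a -> absorbs m b ->
  A S /\ B S <-> cut H m (fun S => K S /\ B S) S \/ cut H m (fun S => A S /\ L S) S.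
Proof.
move=> ma mb abm aa ab; split=> [[hA hB]|[h|h]].
- have [D1 [D2 [[d1 t1 l1 k1] [d2 t2 l2 k2] [[s h]|[s h]]]]] := cut_inter hA hB.
    left; exists D1; split=> // [|x Dx]; last by split; [apply: l1|apply/l2/s].
    by apply: abm => //; apply: ole_olt_trans t2; apply: tp_mono.
  right; exists D2; split=> // [|x Dx]; last by split; [apply/l1/s|apply: l2].
  by apply: abm => //; apply: ole_olt_trans t1; apply: tp_mono.
- split; first by move: h; apply: cut_mono => // [x []//|S' []//].
  apply: (@cut_absorb H G m) => //; first by move=> x [].
  by move: h; apply: cut_mono => // [|S' []//]; apply: ole_refl.
- split; last by move: h; apply: cut_mono => // [x []//|S' []//].
  apply: (@cut_absorb H F m) => //; first by move=> x [].
  by move: h; apply: cut_mono => // [|S' []//]; apply: ole_refl.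
Qed.

(** The minimum of the bounds is now [i + 1], which does not absorb itself in general. A shorter
    segment of length below [i] is treated as in [cut_inter_limit], with [i] in place of [m]. If its
    length is exactly [i], either the bound of the longer segment absorbs [i + 1], or that segment
    has length [i] too and both factors are used up together. *)
Lemma cut_inter_succ i S : ole (osucc i) a -> ole (osucc i) b ->
  (forall u, olt u a -> olt u b -> ole u i) -> absorbs i a -> absorbs i b ->
  (absorbs (osucc i) a \/ ole a (osucc i)) ->
  (absorbs (osucc i) b \/ ole b (osucc i)) ->
  A S /\ B S <->
  cut H i (fun S => K S /\ B S) S \/ cut H i (fun S => A S /\ L S) S \/
      cut H (osucc i) (fun S => K S /\ L S) S \/
      absorbs (osucc i) a /\ cut H (osucc i) (fun S => A S /\ L S) S \/
      absorbs (osucc i) b /\ cut H (osucc i) (fun S => K S /\ B S) S.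
Proof.
move=> ma mb abm aa ab asa asb; split=> [[hA hB]|].
  have [D1 [D2 [[d1 t1 l1 k1] [d2 t2 l2 k2] [[s h]|[s h]]]]] := cut_inter hA hB.
    have lH x : D1 x -> H (wletter x) by move=> Dx; split; [apply: l1|apply/l2/s].
    have ti : ole (tp D1) i.
      by apply: abm => //; apply: ole_olt_trans t2; apply: tp_mono.
    have [it|ti'] := ole_or_olt i (tp D1); last by left; exists D1.
    case: asb => [asb|bi].
      by do 4 right; split=> //; exists D1; split.
    do 2 right; left; exists D1; split=> //.
    (* A letter of [D2] outside [D1] would make [D2] strictly longer than [D1], although [D1] has
       length at least [i] and [D2] at most [i]. *)
    split=> //; apply: hL k2 => x [Sx n1]; split=> // x2.
    apply: (@olt_irr (tp D1)); apply: olt_ole_trans (_ : ole (tp D2) _).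
      exact: tp_down_lt (down_sub s d1 d2) x2 n1.
    by apply: ole_trans it; apply/olt_succ; apply: olt_ole_trans t2 bi.
  have lH x : D2 x -> H (wletter x) by move=> Dx; split; [apply/l1/s|apply: l2].
  have ti : ole (tp D2) i.
    by apply: abm => //; apply: ole_olt_trans t1; apply: tp_mono.
  have [it|ti'] := ole_or_olt i (tp D2); last by right; left; exists D2.
  case: asa => [asa|bi].
    by do 3 right; left; split=> //; exists D2; split.
  do 2 right; left; exists D2; split=> //.
  split=> //; apply: hK k1 => x [Sx n1]; split=> // x2.
  apply: (@olt_irr (tp D2)); apply: olt_ole_trans (_ : ole (tp D1) _).
    exact: tp_down_lt (down_sub s d2 d1) x2 n1.
  by apply: ole_trans it; apply/olt_succ; apply: olt_ole_trans t1 bi.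
have HF : H `<=` F by move=> x [].
have HG : H `<=` G by move=> x [].
have is' : ole i (osucc i) by apply/oltW/olt_succ_diag.
have absA m M : absorbs m a -> cut H m M S -> (forall S, M S -> A S) -> A S.
  move=> am hM MA; apply: (@cut_absorb H F m) => //.
  by move: hM; apply: cut_mono => //; apply: ole_refl.
have absB m M : absorbs m b -> cut H m M S -> (forall S, M S -> B S) -> B S.
  move=> am hM MB; apply: (@cut_absorb H G m) => //.
  by move: hM; apply: cut_mono => //; apply: ole_refl.
have inA m M : ole m (osucc i) -> cut H m M S -> (forall S, M S -> K S) -> A S.
  by move=> mi hM MK; move: hM; apply: cut_mono => //; apply: ole_trans mi ma.
have inB m M : ole m (osucc i) -> cut H m M S -> (forall S, M S -> L S) -> B S.
  by move=> mi hM MK; move: hM; apply: cut_mono => //; apply: ole_trans mi mb.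
have rs := ole_refl (osucc i).
case=> [h|[h|[h|[[am h]|[bm h]]]]]; split;
  by [apply: (inA _ _ _ h) => // ? []|apply: (inB _ _ _ h) => // ? []|
      apply: (absA _ _ _ h) => // ? []|apply: (absB _ _ _ h) => // ? []].
Qed.

End Inter.

(* Cut [S] after its first [i] letters. *)
Lemma cut_split F i c K S : hereditary K -> olt ozero c ->
  cut F (oadd i c) K S <-> cut F (osucc i) (cut F c K) S.
Proof.
move=> hK c0; split=> [[D [d t l k]]|[D [d t l [D' [d' t' l' k]]]]].
  pose E := [set x | D x /\ olt (pos D x) i]; have dE : down E D := down_pos _ _.
  exists E; split.
  - split=> [x [/(proj1 d)]//|x y [Dx xi] Sy yx].
    have Dy := proj2 d _ _ Dx Sy yx; exact: (proj2 dE) (conj Dx xi) Dy yx.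
  - exact/olt_succ/tp_pos.
  - by move=> x [/l].
  exists (D `\` E); split.
  - split=> [x [/(proj1 d)]//|x y [Dx nx] [Sy ny] yx]; split=> //.
    exact: (proj2 d) Dx Sy yx.
  - case: (pselect (exists x, (D `\` E) x)) => [[x [Dx nE]]|n]; last first.
      by apply: ole_olt_trans c0; apply: tp_empty => x Dx; apply: n; exists x.
    (* Some letter of [D] is outside [E], at position at least [i]. So every ordinal below [i] is
       the position of a letter of [D], and that letter is in [E]. *)
    have iE : ole i (tp E).
      have ix : ole i (pos D x) by apply: oleNgt => xi; apply: nE.
      apply/oleP => e ei; have [y [Dy yx] [ey ye]] :
          exists2 y, D y /\ wo_lt y x & oeq e (pos D y).
        apply: (@rank_surj _ _ (relin_wf D)) (olt_ole_trans ei ix).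
        by move=> p q r [Dp pq] [_ qr]; split=> //; apply: wo_trans qr.
      have Ey : E y by split=> //; apply: ole_olt_trans ye ei.
      exact: ole_olt_trans (ole_trans ey (pos_down dE Ey)) (tp_lt Ey).
    apply: (@oadd_ltrI i); apply: ole_olt_trans t.
    have [_ h] := tp_setD dE; apply: ole_trans h; apply: oadd_mono => //.
    exact: ole_refl.
  - by move=> x [/l].
  - by apply: hK k => x [[Sx nE] nD]; split=> // Dx; apply: nD.
exists (D `|` D'); split.
- exact: down_setU.
- have dDU : down D (D `|` D') by apply: down_sub d (down_setU d d') => x; left.
  have [h _] := tp_setD dDU; apply: ole_olt_trans h _.
  apply: ole_olt_trans (oadd_mono (_ : ole _ i) (_ : ole _ (tp D'))) _.
  - exact/olt_succ.
  - by apply: tp_mono => x [[]].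
  - exact: oadd_ltr.
- by move=> x [/l|/l'].
- by apply: hK k => x [Sx /not_orP[]].
Qed.

End Cut.

(** * Normal bounds *)

Lemma oadd0l_le b : ole (oadd ozero b) b.
Proof. exact: ole_trans (oadd_le_onadd ozero b) (onadd0l_le b). Qed.

Lemma oadd_assoc_ge a b c : ole (oadd (oadd a b) c) (oadd a (oadd b c)).
Proof.
elim/(well_founded_ind olt_wf): c => c IH; apply: ole_add.
  by apply: oadd_mono; [apply: ole_refl|apply: ole_addr].
by move=> d dc; apply: ole_olt_trans (IH _ dc) _; do 2 apply: oadd_ltr.
Qed.

Lemma omul_nat_succl a n : ole (oadd (omul a (onat n)) a) (oadd a (omul a (onat n))).
Proof.
elim: n => [|n IH].
  apply: ole_trans (ole_addr _ _).
  exact: ole_trans (oadd_mono (@omul0 a) (ole_refl a)) (oadd0l_le a).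
have [h1 h2] := omul_succ a (onat n).
apply: ole_trans (oadd_mono (ole_trans h1 IH) (ole_refl a)) _.
by apply: ole_trans (oadd_assoc_ge _ _ _) (oadd_mono (ole_refl a) h2).
Qed.

Lemma olt_wf_min (P : ord -> Prop) a : P a ->
  exists2 b, P b & forall c, olt c b -> ~ P c.
Proof.
elim/(well_founded_ind olt_wf): a => a IH Pa.
case: (pselect (exists2 c, olt c a & P c)) => [[c /IH h /h]//|n].
by exists a => // c ca Pc; apply: n; exists c.
Qed.

Lemma opow0_le : ole (opw ozero) (onat 1).
Proof. by apply/oleP => c /olt_opow[c0|[d /olt0]//]; apply/olt_succ. Qed.

Lemma opow_ge2 b : ole (onat 1) b -> olt (onat 1) (opw b).
Proof. by move=> /ole1/opow_lt; apply: ole_olt_trans; apply: opow_ge1. Qed.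

Definition limit_bound b := exists2 e, ole (onat 1) e & oeq b (opw e).
Definition succ_bound b := exists e, oeq b (osucc (opw e)).
(** The proper bounds together with 2, which [succ_bound] provides for [e = 0]: exactly the kinds of
    bounds that atoms have. *)
Definition normal_bound b := limit_bound b \/ succ_bound b.

Lemma proper_bound_limit b : limit_bound b -> proper_bound b.
Proof. by move=> [e e1 be]; exists e; split=> //; left. Qed.

Lemma proper_bound_oeq b b' : oeq b b' -> proper_bound b -> proper_bound b'.
Proof.
move=> /oeq_sym bb [e [e1 h]]; exists e; split=> //.
by case: h => h; [left|right]; apply: oeq_trans h.
Qed.

Lemma proper_normal b : proper_bound b -> normal_bound b.
Proof.
move=> [e [e1 [h|h]]]; [by left; exists e|right; exists e].
exact: oeq_trans h (oadd1 _).
Qed.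

Lemma normal_proper b : normal_bound b -> proper_bound b \/ oeq b (onat 2).
Proof.
case=> [h|[e h]]; first by left; apply: proper_bound_limit.
case: (ole_or_olt (onat 1) e) => [e1|/olt_succ e0].
  by left; exists e; split=> //; right; apply/(oeq_trans h)/oeq_sym/oadd1.
right; apply/(oeq_trans h)/oeq_succ; split; last exact: opow_ge1.
exact: ole_trans (opow_mono e0) opow0_le.
Qed.

Lemma limit_ge2 b : limit_bound b -> ole (onat 2) b.
Proof. by move=> [e /opow_ge2 e1 [_ h]]; apply/ole_succ; apply: olt_ole_trans h. Qed.

Lemma succ_ge2 b : succ_bound b -> ole (onat 2) b.
Proof.
move=> [e [_ h]]; apply: ole_trans h; apply/ole_succ/olt_succ; exact: opow_ge1.
Qed.

Lemma normal_ge2 b : normal_bound b -> ole (onat 2) b.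
Proof. by case; [apply: limit_ge2|apply: succ_ge2]. Qed.

Lemma normal_gt0 b : normal_bound b -> olt ozero b.
Proof.
move/normal_ge2; apply: olt_ole_trans; apply/olt_succ; exact: ole0.
Qed.

Lemma absorbs_oeq m m' b b' : ole m' m -> oeq b b' -> absorbs m b -> absorbs m' b'.
Proof.
move=> mm [bb bb'] h u v um vb; apply: olt_ole_trans bb.
by apply: h; [apply: olt_ole_trans um mm|apply: olt_ole_trans vb bb'].
Qed.

Lemma absorbs1 b : absorbs (onat 1) b.
Proof.
move=> u v /olt_succ u0 vb; apply: ole_olt_trans vb.
by apply: ole_trans (oadd0l_le v); apply: oadd_mono => //; apply: ole_refl.
Qed.

Lemma absorbs_pow e d : ole e d -> absorbs (opw e) (opw d).
Proof.
move=> ed u v ue vd; apply: opow_oadd => //.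
by apply: olt_ole_trans ue _; apply: opow_mono.
Qed.

Lemma absorbs_pow_succ e d : ole (opw e) (opw d) -> absorbs (opw e) (osucc (opw d)).
Proof.
move=> ed u v ue /olt_succ vd; apply/olt_succ/opow_oadd_le => //.
exact: olt_ole_trans ue ed.
Qed.

Lemma opow_leI e d : ole (opw e) (opw d) -> ole e d.
Proof. by move=> h; apply: oleNgt => /opow_lt; apply: ole_oltN. Qed.

Lemma opow_ltI e d : olt (opw e) (opw d) -> olt e d.
Proof. by move=> h; apply: oltNge => /opow_mono; move/ole_oltN; apply. Qed.

Lemma absorbs_limit m b : limit_bound m -> normal_bound b -> ole m b -> absorbs m b.
Proof.
move=> [e e1 [me em]] [[d d1 [bd db]]|[d [bd db]]] mb.
  apply: (@absorbs_oeq (opw e) _ (opw d)) => //.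
  by apply/absorbs_pow/opow_leI; apply: ole_trans em (ole_trans mb bd).
apply: (@absorbs_oeq (opw e) _ (osucc (opw d))) => //.
apply: absorbs_pow_succ; apply: oleNgt => de.
(* If [d] were below [e], then [omega^d + 1] would be below [omega^e], but [m] is between [omega^e]
   and [omega^d + 1]. *)
have h := opow_oadd de (opow_ge2 e1); apply: (@olt_irr (opw e)).
apply: ole_olt_trans h; apply: ole_trans em (ole_trans mb (ole_trans bd _)).
by case: (oadd1 (opw d)).
Qed.

Lemma absorbs_below_succ e b : normal_bound b ->
  ole (osucc (opw e)) b -> absorbs (opw e) b.
Proof.
move=> [[d d1 [bd db]]|[d [bd db]]] /ole_succ eb.
  apply: (@absorbs_oeq (opw e) _ (opw d)) => //; first exact: ole_refl.
  by apply/absorbs_pow/oltW/opow_ltI; apply: olt_ole_trans eb bd.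
apply: (@absorbs_oeq (opw e) _ (osucc (opw d))) => //; first exact: ole_refl.
by apply/absorbs_pow_succ/olt_succ; apply: olt_ole_trans eb bd.
Qed.

Lemma absorbs_succ e b : normal_bound b -> olt (osucc (opw e)) b ->
  absorbs (osucc (opw e)) b.
Proof.
move=> [[d d1 [bd db]]|[d [bd db]]] eb u v /olt_succ ue vb.
  have ed : olt (opw e) (opw d).
    by apply: olt_ole_trans bd; apply: olt_trans eb; apply: olt_succ_diag.
  apply: olt_ole_trans db; apply: opow_oadd; first exact: ole_olt_trans ue ed.
  exact: olt_ole_trans vb bd.
apply: olt_ole_trans db; apply/olt_succ/opow_oadd_le.
  by apply: ole_olt_trans ue _; apply/ole_succ/olt_succ; apply: olt_ole_trans eb bd.
exact/olt_succ/(olt_ole_trans vb bd).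
Qed.

(** Two words of length [i] have a concatenation of length [i + i], which exceeds [i]. *)
Lemma not_absorbs_succ i : olt ozero i -> ~ absorbs (osucc i) (osucc i).
Proof.
move=> i0 h; have /olt_succ hi := h i i (olt_succ_diag i) (olt_succ_diag i).
apply: (@olt_irr i); apply: olt_ole_trans hi.
by apply: ole_olt_trans (oadd_ltr i i0); apply: ole_addr.
Qed.

(** Take the least [e] with [b] at most [omega^e]. Equality gives the first two cases. Otherwise [b]
    lies strictly between some [omega^d] with [d < e] and a finite multiple of it, and [c] is
    obtained by subtracting [omega^d] from [b] on the left. *)
Lemma bound_decomp b : olt ozero b ->
  [\/ ole b (onat 1), normal_bound b |
      exists e c, [/\ oeq b (oadd (opw e) c), olt ozero c & olt c b]].
Proof.
move=> b0; have [e be emin] := @olt_wf_min (fun e => ole b (opw e)) b (ole_opow_self b).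
case: (ole_or_olt (opw e) b) => [eb|].
  case: (ole_or_olt (onat 1) e) => [e1|/olt_succ e0].
    by apply: Or32; left; exists e.
  by apply: Or31; apply: ole_trans be (ole_trans (opow_mono e0) opow0_le).
case/olt_opow => [|[d de [n bd]]]; first by move/ole_oltN.
have db : olt (opw d) b := oltNge (emin d de).
have [bs sb] := oadd_osub (oltW db); apply: Or33.
exists d, (osub (opw d) b); split=> //.
  apply: oltNge => c0; apply: ole_oltN db; apply: ole_trans bs _.
  apply: ole_trans (oadd_mono (ole_refl _) c0) _; by case: (oadd0 (opw d)).
(* If subtracting [omega^d] did not lower [b], then [omega^d + b] would be at most [b], and [b]
   would bound every finite multiple of [omega^d]. *)
apply: oltNge => bc.
have hk k : ole (omul (opw d) (onat k)) b.
  elim: k => [|k IH]; first exact: ole_trans (@omul0 _) (ole0 _).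
  have [h _] := omul_succ (opw d) (onat k); apply: ole_trans h _.
  apply: ole_trans (omul_nat_succl _ _) _; apply: ole_trans sb.
  by apply: oadd_mono; [apply: ole_refl|apply: ole_trans IH bc].
apply: ole_oltN bd; apply: ole_trans (hk n.+1).
by case: (omul_succ (opw d) (onat n)).
Qed.

(** * Rewriting products with normal bounds only *)

Section Products.
Variable X : topologicalType.
Implicit Types (F G : closed_set X) (s t Q : seq (closed_set X * ord)) (w : word X).

Fixpoint inprod s w : set (wlen w) -> Prop :=
  match s with
  | [::] => fun S => forall x, ~ S x
  | p :: s' => cut (sval p.1) p.2 (@inprod s' w)
  end.

Lemma inprod_hered s w : hereditary (@inprod s w).
Proof.
elim: s => [S S' SS h x /SS/h//|[F a] s IH]; exact: cut_hered.
Qed.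

Definition normal s := forall p, List.In p s -> normal_bound p.2.

Lemma normal_cons p s : normal (p :: s) -> normal_bound p.2 /\ normal s.
Proof. by move=> h; split=> [|q qs]; apply: h; [left|right]. Qed.

Lemma inprod_empty s w S : normal s -> (forall x, ~ S x) -> inprod s (w := w) S.
Proof.
elim: s => // [[F a] s IH] /normal_cons[a0 /IH h] /h; apply: cut_skip.
  exact: inprod_hered.
exact: normal_gt0.
Qed.

Lemma cut_ext w (F : set X) a (K K' : set (wlen w) -> Prop) S :
  (forall S, K S <-> K' S) -> cut F a K S <-> cut F a K' S.
Proof.
by move=> h; split; apply: cut_mono => //; first [apply: ole_refl|move=> ? /h].
Qed.

Lemma cut_oeq w (F : set X) a a' (K : set (wlen w) -> Prop) S :
  oeq a a' -> cut F a K S <-> cut F a' K S.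
Proof. by move=> [h h']; split; apply: cut_mono. Qed.

Lemma cut_le1 w (F : set X) a (K : set (wlen w) -> Prop) S : hereditary K ->
  olt ozero a -> ole a (onat 1) -> cut F a K S <-> K S.
Proof.
move=> hK a0 a1; split; last exact: cut_skip.
move=> [D [d t l k]]; apply: hK k => x Sx; split=> // /tp_gt0.
by apply: ole_oltN; apply/olt_succ; apply: olt_ole_trans t a1.
Qed.

(** Recursion along [bound_decomp]: [F^{<1}] holds just the empty word and disappears, a normal
    bound is kept, and [F^{<omega^e + c}] is cut by [cut_split] into [F^{<omega^e + 1} F^{<c}],
    where [c] is smaller than the bound. *)
Lemma norm_atom F b : olt ozero b -> exists2 t, normal t &
  forall s w S, inprod ((F, b) :: s) (w := w) S <-> inprod (t ++ s) S.
Proof.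
elim/(well_founded_ind olt_wf): b => b IH b0.
case: (bound_decomp b0) => [b1|nb|[e [c [bc c0 cb]]]].
- exists [::] => // s w S; apply: cut_le1 => //; exact: inprod_hered.
- by exists [:: (F, b)] => // p [<-|[]].
have [t nt ht] := IH c cb c0; exists ((F, osucc (opw e)) :: t).
  by move=> p [<-|/nt//]; right; exists e; apply: oeq_refl.
move=> s w S; rewrite [inprod _ _]/= (cut_oeq _ _ _ bc) cut_split //; last first.
  exact: inprod_hered.
by apply: cut_ext => S'; apply: (ht s w S').
Qed.

(** The first alternative accounts for a factor with bound 0, which contains no word, not even the
    empty one. *)
Lemma norm_prod s : (forall w S, ~ inprod s (w := w) S) \/
  exists2 t, normal t & forall w S, inprod s (w := w) S <-> inprod t S.
Proof.
elim: s => [|[F b] s [IH|[t nt ht]]]; first by right; exists [::].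
  by left=> w S [D [_ _ _ /IH]].
case: (ole_or_olt b ozero) => b0.
  by left=> w S [D [_ h _ _]]; apply: (@olt0 (tp D)); apply: olt_ole_trans b0.
have [t' nt' ht'] := norm_atom F b0; right; exists (t' ++ t).
  by move=> p /List.in_app_iff[/nt'|/nt].
move=> w S; rewrite -ht'; apply: cut_ext => S'; exact: ht.
Qed.

End Products.

(** * Atoms and their weights *)

Section Pieces.
Variables (X : topologicalType) (hX : noetherian X) (L : wellOrder).

Inductive atom :=
  | Letter of closed_set X
  | Bounded of closed_set X & proper_below L.

Definition base A := match A with Letter F => F | Bounded F _ => F end.

Definition bnd A :=
  match A with Letter _ => onat 2 | Bounded _ x => below_otype (sval x) end.

Definition sem (P : seq atom) := [seq (base A, bnd A) | A <- P].

Definition stat (F : closed_set X) : ord := rank (noetherian_closed_wf hX) F.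

Definition brk (x : proper_below L) : ord := rank (@proper_below_wf L) x.

Definition phi A :=
  match A with
  | Letter F => stat F
  | Bounded F x => opw (ocirc (onadd (stat F) (brk x)))
  end.

Definition mu (P : seq atom) := foldr (fun A m => onadd (phi A) m) ozero P.

Lemma stat_le (F G : closed_set X) : sval F `<=` sval G -> ole (stat F) (stat G).
Proof.
move=> FG; apply: rank_sub => C [CF nFC]; split; first exact: subset_trans CF FG.
by move=> /(subset_trans FG).
Qed.

Lemma stat_lt (F G : closed_set X) :
  sval F `<=` sval G -> ~ sval G `<=` sval F -> olt (stat F) (stat G).
Proof. by move=> FG GF; apply: rank_lt. Qed.

Lemma brk_le x y : ole (below_otype (sval x)) (below_otype (sval y)) ->
  ole (brk x) (brk y).
Proof. by move=> xy; apply: rank_sub => z h; apply: olt_ole_trans h xy. Qed.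

Lemma below_otype_surj (x : option L) b : olt b (below_otype x) ->
  exists a : L, oeq b (rank (@wo_wf L) a).
Proof.
have tr := @wo_trans L.
case: x => [a|] /=; first by case/(rank_surj tr) => c _ h; exists c.
case=> a h; case: (ole_or_olt (rank (@wo_wf L) a) b) => [h'|]; first by exists a.
by case/(rank_surj tr) => c _ h'; exists c.
Qed.

Lemma bnd_normal A : normal_bound (bnd A).
Proof.
case: A => [F|F x] /=; last exact: proper_normal (svalP x).
right; exists ozero; apply: oeq_succ; split; [exact: opow_ge1|exact: opow0_le].
Qed.

Lemma stat_lt_phi F G x : sval F `<=` sval G -> olt (stat F) (phi (Bounded G x)).
Proof.
move=> FG; apply: ole_olt_trans (olt_opow_ocirc _).
exact: ole_trans (stat_le FG) (ole_onaddr _ _).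
Qed.

(** The natural sum is strictly increasing on each side, and both [ocirc] and the powers of omega
    preserve strict inequalities. *)
Lemma phi_lt F G x y : sval F `<=` sval G ->
  ole (below_otype (sval x)) (below_otype (sval y)) ->
  ~ sval G `<=` sval F \/ olt (below_otype (sval x)) (below_otype (sval y)) ->
  olt (phi (Bounded F x)) (phi (Bounded G y)).
Proof.
move=> FG xy h; apply/opow_lt/ocirc_lt; case: h => [GF|xy'].
  by apply: onadd_lt; [apply: stat_lt|apply: brk_le].
apply: ole_olt_trans (onadd_mono (stat_le FG) (ole_refl _)) _.
by apply: onadd_ltr; apply: rank_lt.
Qed.

Definition closed_empty : closed_set X := exist _ set0 closed0.

Definition closed_cap (F G : closed_set X) : closed_set X :=
  exist _ (sval F `&` sval G) (closedI (svalP F) (svalP G)).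

(** Whatever is cut off the head [F^{<g}] is an atom again, and a lighter one. A proper [m] gives a
    smaller pair of a closed set and a bound; for [m] equal to 2 the atom is a [Letter], lighter
    even when [H] is [F], thanks to [stat_lt_phi]. *)
Lemma smaller_atom F x (H : closed_set X) m :
  sval H `<=` sval F -> oeq m (onat 1) \/ normal_bound m ->
  ole m (below_otype (sval x)) ->
  ~ sval F `<=` sval H \/ olt m (below_otype (sval x)) ->
  exists2 E, olt (phi E) (phi (Bounded F x)) &
    forall w (K : set (wlen w) -> Prop) S, hereditary K ->
      cut (sval (base E)) (bnd E) K S <-> cut (sval H) m K S.
Proof.
move=> HF; case=> [m1|/normal_proper[pm|m2]] mx h.
- (* The language reduced to the empty word is the atom [set0^{<2}]. *)
  exists (Letter closed_empty); first by apply: stat_lt_phi => y [].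
  move=> w K S hK; rewrite (@cut_le1 _ _ _ m) //; [|by apply/ole1; case: m1|by case: m1].
  split=> [[D [d t l k]]|]; last by apply: cut_skip => //; apply/olt_succ/ole0.
  by apply: hK k => y Sy; split=> // /l.
- have [y my yx] : exists2 y : proper_below L, oeq m (below_otype (sval y)) &
      (olt m (below_otype (sval x)) -> olt (below_otype (sval y)) (below_otype (sval x))) /\
      ole (below_otype (sval y)) (below_otype (sval x)).
    (* If [m] is the bound of [x], take [x] itself, so that no strictness is claimed; otherwise [m]
       is the rank of an element of [L]. *)
    case: (ole_or_olt (below_otype (sval x)) m) => [xm|].
      by exists x => //; split; [move/(ole_olt_trans xm)/olt_irr|apply: ole_refl].
    move=> mx'; have [a ma] := below_otype_surj mx'.
    exists (exist _ (Some a) (proper_bound_oeq ma pm)) => //=.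
    by case: ma => _ am; split=> [_|]; [exact: ole_olt_trans am mx'|exact: ole_trans am mx].
  exists (Bounded H y); last by move=> w K S hK; split; apply: cut_mono => //; case: my.
  by apply: phi_lt => //; [apply: yx.2|case: h => [|/yx.1]; [left|right]].
- exists (Letter H); first exact: stat_lt_phi.
  by move=> w K S hK; split; apply: cut_mono => //; case: m2.
Qed.

(** * Languages that are finite unions of products of atoms *)

Definition lang := forall w : word X, set (wlen w) -> Prop.

Definition rep (K : lang) (g : seq atom -> Prop) := exists Rs : seq (seq atom),
  (forall w S, K w S <-> exists2 R, List.In R Rs & inprod (sem R) S) /\
  forall R, List.In R Rs -> g R.

Lemma rep_ext (K K' : lang) g :
  (forall w S, K w S <-> K' w S) -> rep K g -> rep K' g.
Proof. by move=> KK [Rs [h1 h2]]; exists Rs; split=> // w S; rewrite -KK. Qed.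

Lemma rep_sub K (g g' : seq atom -> Prop) : (forall R, g R -> g' R) -> rep K g -> rep K g'.
Proof. by move=> gg [Rs [h1 h2]]; exists Rs; split=> // R /h2/gg. Qed.

Lemma rep1 R (g : seq atom -> Prop) : g R -> rep (fun w => @inprod X (sem R) w) g.
Proof.
move=> gR; exists [:: R]; split=> [w S|_ [<-|[]]//].
by split=> [h|[_ [<-|[]]]//]; exists R => //; left.
Qed.

Lemma rep0 g : rep (fun w S => False) g.
Proof. by exists [::]; split=> // w S; split=> // -[]. Qed.

Lemma rep_or (K K' : lang) g : rep K g -> rep K' g -> rep (fun w S => K w S \/ K' w S) g.
Proof.
move=> [Rs [h1 h2]] [Rs' [h1' h2']]; exists (Rs ++ Rs').
split=> [w S|R /List.in_app_iff[/h2|/h2']//].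
rewrite h1 h1'; split=> [[|] [R hR RS]|[R /List.in_app_iff[hR|hR] RS]].
- by exists R => //; apply/List.in_app_iff; left.
- by exists R => //; apply/List.in_app_iff; right.
- by left; exists R.
- by right; exists R.
Qed.

Lemma rep_and (p : Prop) (K : lang) g : (p -> rep K g) -> rep (fun w S => p /\ K w S) g.
Proof.
case: (pselect p) => [hp /(_ hp)|np _]; [|move: (rep0 g)]; apply: rep_ext => w S.
  by split=> [//|[]].
by split=> [//|[]].
Qed.

(** Prepending [F^{<m}] distributes over finite unions, so it is enough to treat each product
    separately. *)
Lemma rep_cut (F : set X) m (K : lang) (g g' : seq atom -> Prop) : rep K g ->
  (forall R, g R -> exists2 R', g' R' &
    forall w S, inprod (sem R') (w := w) S <-> cut F m (@inprod X (sem R) w) S) ->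
  rep (fun w => cut F m (K w)) g'.
Proof.
move=> [Rs [h1 h2]] h.
apply: (@rep_ext (fun w =>
    cut F m (fun S => exists2 R, List.In R Rs & inprod (sem R) S))).
  by move=> w S; apply: cut_ext => S'; rewrite h1.
elim: Rs h2 {h1} => [_|R Rs IH h2].
  by apply: rep_ext (rep0 g') => w S; split=> // -[D [_ _ _ []]].
have [R' gR' ER'] := h R (h2 R (or_introl erefl)).
apply: rep_ext (rep_or (rep1 gR') (IH (fun R0 hR => h2 R0 (or_intror hR)))) => w S.
rewrite ER'; split=> [[]|[D [d t l [R0 [<-|hR] k]]]].
- by apply: cut_mono => // [|S' k]; [apply: ole_refl|exists R => //; left].
- apply: cut_mono => // [|S' [R0 hR k]]; first exact: ole_refl.
  by exists R0 => //; right.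
- by left; exists D.
- by right; exists D; split=> //; exists R0.
Qed.

End Pieces.

(** * Intersecting products *)

Section Intersection.
Variables (X : topologicalType) (hX : noetherian X) (L : wellOrder).
Implicit Types (P R : seq (atom X L)) (Q : seq (closed_set X * ord)).
Local Notation mu := (@mu X hX L).
Local Notation phi := (@phi X hX L).

(* [R] is smaller than [P] because either its part up to the first atom of [P]
   got smaller than that atom, or it got smaller beyond that atom. *)
Definition good P R : Prop :=
  match P with
  | [::] => False
  | Letter _ :: _ => olt (mu R) (mu P)
  | (Bounded _ _ as A) :: P' =>
      (exists2 e, olt e (phi A) & ole (mu R) (onadd e (mu P'))) \/
      (exists2 R', R = A :: R' & olt (mu R') (mu P'))
  end.

Lemma good_mu P R : good P R -> olt (mu R) (mu P).
Proof.
case: P => [//|[F//|F x] P'] [[e eA h]|[R' -> h]] /=.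
  by apply: ole_olt_trans h (onadd_ltl _ eA).
exact: onadd_ltr.
Qed.

Lemma good_cons F x P' E R : olt (phi E) (phi (Bounded F x)) ->
  ole (mu R) (mu P') -> good (Bounded F x :: P') (E :: R).
Proof.
by move=> EA h; left; exists (phi E) => //=; apply: onadd_mono => //; apply: ole_refl.
Qed.

(** The reason for [good]. If the head of [R] has already shrunk, the weight of [E] is added to the
    one that replaces the head, and both are below a power of omega, hence so is their natural sum.
    If [R] still begins with the whole atom, this atom absorbs [H^{<m}] and [R] itself is the
    answer. *)
Lemma good_absorb F x P' E R (H : set X) m :
  olt (phi E) (phi (Bounded F x)) -> H `<=` sval F -> olt ozero m ->
  absorbs m (below_otype (sval x)) ->
  (forall w (K : set (wlen w) -> Prop) S, hereditary K ->
      cut (sval (base E)) (bnd E) K S <-> cut H m K S) ->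
  good (Bounded F x :: P') R ->
  exists2 R', good (Bounded F x :: P') R' &
    forall w S, inprod (sem R') (w := w) S <-> cut H m (@inprod X (sem R) w) S.
Proof.
move=> EA HF m0 mx hE [[e eA h]|[R' -> h]].
  exists (E :: R); last by move=> w S; apply: hE; apply: inprod_hered.
  left; exists (onadd (phi E) e); first exact: opow_onadd.
  by apply: ole_trans (onaddA_le _ _ _); apply: onadd_mono => //; apply: ole_refl.
exists (Bounded F x :: R'); first by right; exists R'.
move=> w S; split; first by apply: cut_skip => //; apply: inprod_hered.
by apply: cut_absorb => //; apply: inprod_hered.
Qed.

Definition inter P Q : lang X := fun w S => inprod (sem P) (w := w) S /\ inprod Q S.

Lemma inter_hered P Q w : hereditary (@inter P Q w).
Proof.
by move=> S S' SS [h1 h2]; split; [apply: inprod_hered h1|apply: inprod_hered h2].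
Qed.

Definition contained P Q := forall w S, inprod (sem P) (w := w) S -> inprod Q S.

Definition splits P Q := contained P Q \/ rep (inter P Q) (good P).

Lemma splits_le P Q : splits P Q -> rep (inter P Q) (fun R => ole (mu R) (mu P)).
Proof.
case=> [PQ|]; last by apply: rep_sub => R /good_mu/oltW.
apply: rep_ext (rep1 (R := P) (ole_refl _)) => w S.
by split=> [h|[]//]; split=> //; apply: PQ.
Qed.

Lemma splits_lt P Q : splits P Q ->
  contained P Q \/ rep (inter P Q) (fun R => olt (mu R) (mu P)).
Proof. by case=> [|r]; [left|right; apply: rep_sub r => R /good_mu]. Qed.

Lemma sem_normal P : normal (sem P).
Proof. by elim: P => // A P IH p [<-|/IH//]; apply: bnd_normal. Qed.

Lemma contained_cons P p Q : normal_bound p.2 -> contained P Q -> contained P (p :: Q).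
Proof.
move=> np h w S /h; apply: cut_skip; [exact: inprod_hered|exact: normal_gt0].
Qed.

(** Induction on [Q] inside the induction on the left product. The head [C^{<2}] meets [G^{<b}]
    through [cut_inter_succ] with [i = 1]; each piece is lighter because the head has gone, has
    shrunk, or is followed by something lighter than [P], or else by the induction hypothesis on
    [Q]. *)
Lemma splits_letter (C : closed_set X) P :
  (forall Q, normal Q -> splits P Q) ->
  forall Q, normal Q -> splits (Letter L C :: P) Q.
Proof.
move=> IHP; case: (pselect (exists c, sval C c)) => [[c Cc]|nC]; last first.
  (* An empty [C] weighs 0, so removing the head would not lower the weight; but the product then
     equals [P]. *)
  have E w S : inprod (sem (Letter L C :: P)) (w := w) S <-> inprod (sem P) S.
    split=> [[D [d t l k]]|]; last first.
      apply: cut_skip; [exact: inprod_hered|apply/olt_succ; exact: ole0].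
    apply: inprod_hered k => x Sx; split=> // /l Cx; apply: nC; by exists (wletter x).
  move=> Q nQ; case: (splits_lt (IHP Q nQ)) => [h|h]; [left=> w S /E/h//|right].
  apply: rep_ext (rep_sub _ h) => [w S|R hR]; first by rewrite /inter E.
  by apply: olt_ole_trans hR _; apply: ole_onaddl.
have C0 : olt ozero (stat hX C).
  apply: ole_olt_trans (stat_lt hX (F := closed_empty X) (G := C) _ _); first exact: ole0.
  - by move=> x.
  - by move/(_ c Cc).
have PC : olt (mu P) (mu (Letter L C :: P)).
  by apply: ole_olt_trans (onadd_ltl _ C0); apply: ole_onaddl.
elim=> [_|[G b] Q IHQ /normal_cons[/= nb nQ]].
  right; apply: rep_ext (rep1 (R := [::]) _) => [w S|]; last first.
    by apply: ole_olt_trans PC; apply: ole0.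
  split=> [h|[]//]; split=> //; exact: (@inprod_empty X (sem _) w S (@sem_normal _)).
have nGQ : normal ((G, b) :: Q) by move=> p [<-|/nQ].
case: (IHQ nQ) => [h|rPQ']; first by left; apply: contained_cons.
pose H := sval C `&` sval G.
(* A piece [H^{<2} (P /\ Z)]. If [C] is not included in [G], the head gets lighter and [P /\ Z] may
   weigh as much as [P]. If it is, the head keeps its weight, so [P /\ Z] has to be lighter than
   [P]; this fails only when [P] is included in [Z], which [hZ] turns into containment of the
   whole. *)
have tail Z : normal Z ->
    (contained P Z -> sval C `<=` sval G ->
      contained (Letter L C :: P) ((G, b) :: Q)) ->
    contained (Letter L C :: P) ((G, b) :: Q) \/
    rep (fun w => cut H (onat 2) (@inter P Z w)) (good (Letter L C :: P)).
  move=> nZ hZ; have pre R : exists2 R', R' = Letter L (closed_cap C G) :: R &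
      forall w S, inprod (sem R') (w := w) S <-> cut H (onat 2) (@inprod X (sem R) w) S.
    by exists (Letter L (closed_cap C G) :: R).
  case: (pselect (sval C `<=` sval G)) => CG.
    case: (splits_lt (IHP Z nZ)) => [PZ|r]; first by left; apply: hZ.
    right; apply: rep_cut r _ => R hR; have [R' eR' hR'] := pre R; exists R' => //.
    rewrite eR' /good /=; apply: ole_olt_trans (onadd_ltr _ hR).
    by apply: onadd_mono (ole_refl _); apply: stat_le => x [].
  right; apply: rep_cut (splits_le (IHP Z nZ)) _ => R hR.
  have [R' eR' hR'] := pre R; exists R' => //.
  rewrite eR' /good /=; apply: onadd_lt => //; apply: stat_lt; first by move=> x [].
  by move=> h; apply: CG => x /h[].
case: (tail Q nQ) => [PQ' CG w S|h|rQ']; [|by left|].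
  by apply: cut_mono => //; [apply: normal_ge2|apply: PQ'].
have hG : absorbs (onat 2) b ->
    contained P ((G, b) :: Q) -> sval C `<=` sval G ->
    contained (Letter L C :: P) ((G, b) :: Q).
  move=> ab2 PQ' CG w S h; apply: (cut_absorb (@inprod_hered _ _ _) CG ab2).
  by move: h; apply: cut_mono => //; [apply: ole_refl|apply: PQ'].
have [cont|rQ] : contained (Letter L C :: P) ((G, b) :: Q) \/ (absorbs (onat 2) b ->
    rep (fun w => cut H (onat 2) (@inter P ((G, b) :: Q) w)) (good (Letter L C :: P))).
  case: (pselect (absorbs (onat 2) b)) => ab2; last by right.
  by case: (tail _ nGQ (hG ab2)) => [h|r]; [left|right].
  by left.
have b2 := normal_ge2 nb; right.
have cut1 (K : lang X) (g : seq (atom X L) -> Prop) :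
    (forall w, hereditary (K w)) -> rep K g ->
    rep (fun w => cut H (onat 1) (K w)) g.
  move=> hK; apply: rep_ext => w S; apply: iff_sym; apply: cut_le1 => //.
    exact: olt_succ_diag.
  exact: ole_refl.
have r1 : rep (inter P ((G, b) :: Q)) (good (Letter L C :: P)).
  by apply: rep_sub (splits_le (IHP _ nGQ)) => R hR; apply: ole_olt_trans hR PC.
have bS : absorbs (onat 2) b \/ ole b (onat 2).
  case: (ole_or_olt b (onat 2)) => [|b2']; [by right|left].
  (* The bound 2 is read as [omega^0 + 1] in order to use [absorbs_succ]. *)
  have e0 : oeq (onat 1) (opw ozero) by split; [apply: opow_ge1|apply: opow0_le].
  apply: (@absorbs_oeq (osucc (opw ozero)) _ b) (oeq_refl b) (absorbs_succ nb _).
    by case: (oeq_succ e0).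
  by apply: ole_olt_trans b2'; case: (oeq_succ e0).
apply: (rep_ext (fun w S => iff_sym (@cut_inter_succ X w (sval C) (sval G) (onat 2) b
  (@inprod X (sem P) w) (@inprod X Q w) (@inprod_hered _ _ _) (@inprod_hered _ _ _)
  (onat 1) S (ole_refl _) b2 (fun u u2 _ => (olt_succ u (onat 1)).1 u2)
  (@absorbs1 _) (@absorbs1 _) (or_intror (ole_refl _)) bS))).
apply: rep_or; first exact: cut1 (@inter_hered _ _) r1.
apply: rep_or; first exact: cut1 (@inter_hered _ _) rPQ'.
apply: rep_or; first exact: rQ'.
apply: rep_or; last by apply: rep_and => /rQ.
by apply: rep_and => /not_absorbs_succ h; case: h; apply/olt_succ/ole_refl.
Qed.

(** Again by induction on [Q]. When [F^{<a}] cannot simply be removed in front of [G^{<b}], the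
    intersection is cut along [H^{<m}] with [m] the minimum of [a] and [b], or along [H^{<i}] and
    [H^{<i+1}] when [m] is a successor. In general these are strictly smaller than [F^{<a}]; the
    exceptional case is settled by a decrease in the tail. *)
Lemma splits_bounded F (x : proper_below L) P :
  (forall Q, normal Q -> splits P Q) ->
  forall Q, normal Q -> splits (Bounded F x :: P) Q.
Proof.
move=> IHP; pose a := below_otype (sval x); pose A := Bounded F x.
have na : normal_bound a := bnd_normal A.
elim=> [_|[G b] Q IHQ /normal_cons[/= nb nQ]].
  right; apply: rep_ext (rep1 (R := [::]) _) => [w S|]; last first.
    by left; exists ozero; [apply: opow_gt0|apply: ole0].
  split=> [h|[]//]; split=> //; exact: (@inprod_empty X (sem _) w S (@sem_normal _)).
have nGQ : normal ((G, b) :: Q) by move=> p [<-|/nQ].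
case: (IHQ nQ) => [h|rPQ']; first by left; apply: contained_cons.
have hP w := @inprod_hered X (sem P) w.
have hQ w := @inprod_hered X Q w.
have rP'Q : rep (inter P ((G, b) :: Q)) (fun R => ole (mu R) (mu P)) :=
  splits_le (IHP _ nGQ).
pose FG := closed_cap F G; pose H : set X := sval F `&` sval G.
have HF : H `<=` sval F by move=> y [].
(* By [cut_inter_absorb] the intersection is [F^{<a}] followed by [P /\ G^{<b} Q], so the dichotomy
   for [P] against [G^{<b} Q] decides. *)
case: (pselect [/\ sval F `<=` sval G, ole a b & absorbs a b]) => [[FG' ab aab]|nabs].
  have E w S := @cut_inter_absorb X w (sval F) (sval G) a b (@inprod X (sem P) w)
    (@inprod X Q w) (hP w) (hQ w) S FG' ab aab (normal_gt0 nb).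
  case: (splits_lt (IHP _ nGQ)) => [PQ|r].
    left=> w S h; apply: ((E w S).2 _).2; move: h.
    apply: cut_mono => //; first exact: ole_refl.
    by move=> S' h; split=> //; apply: PQ.
  right; apply: (rep_ext (fun w S => iff_sym (E w S))); apply: rep_cut r _ => R hR.
  by exists (A :: R) => //; right; exists R.
(* As soon as [H^{<m}] is strictly smaller than [F^{<a}], the first two pieces are good with a tail
   no heavier than [P]. The third one still contains [F^{<a}], and relies on the induction on [Q]
   with [good_absorb]. *)
have pieces m : oeq m (onat 1) \/ normal_bound m -> ole m a -> olt ozero m ->
    (~ sval F `<=` H \/ olt m a) ->
    rep (fun w => cut H m (@inter P ((G, b) :: Q) w)) (good (A :: P)) /\
    rep (fun w => cut H m (@inter P Q w)) (good (A :: P)) /\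
    (absorbs m a -> rep (fun w => cut H m (@inter (A :: P) Q w)) (good (A :: P))).
  move=> nm ma m0 h; have [E EA hE] := smaller_atom hX (H := FG) HF nm ma h.
  have pre R : ole (mu R) (mu P) -> exists2 R', good (A :: P) R' &
      forall w S, inprod (sem R') (w := w) S <-> cut H m (@inprod X (sem R) w) S.
    move=> hR; exists (E :: R); first exact: good_cons.
    by move=> w S; apply: hE; apply: inprod_hered.
  split; first by apply: rep_cut rP'Q _.
  split; first by apply: rep_cut (splits_le (IHP _ nQ)) _.
  move=> abs; apply: rep_cut rPQ' _ => R; exact: good_absorb EA HF m0 abs hE.
have [m [nm [ma mb] abm]] : exists m, [/\ normal_bound m, ole m a /\ ole m b &
    forall u, olt u a -> olt u b -> olt u m].
  case: (ole_or_olt a b) => [ab|/oltW ba]; last by exists b; split=> //; split=> //; apply: ole_refl.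
  by exists a; split=> //; split=> //; apply: ole_refl.
case: (nm) => [lm|[e [me em]]].
  have mab := absorbs_limit lm nb mb; have maa := absorbs_limit lm na ma.
  (* If neither the closed set nor the bound got smaller, then [F] is included in [G], and [a] is at
     most [m], which [b] absorbs: the case already excluded by [nabs]. *)
  have st : ~ sval F `<=` H \/ olt m a.
    case: (pselect (sval F `<=` H)) => FH; [right|by left].
    apply: oltNge => am; apply: nabs; split; first by move=> y /FH[].
      exact: ole_trans am mb.
    by apply: absorbs_oeq mab => //; apply: oeq_refl.
  have [r1 [_ r2]] := pieces m (or_intror nm) ma (normal_gt0 nm) st.
  right; apply: (rep_ext (fun w S => iff_sym (@cut_inter_limit X w (sval F) (sval G) a b
    (@inprod X (sem P) w) (@inprod X Q w) (hP w) (hQ w) m S ma mb abm maa mab))).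
  by apply: rep_or r1 (r2 maa).
pose i := opw e; have im : olt i m by apply: olt_ole_trans em; apply: olt_succ_diag.
have sia : ole (osucc i) a := ole_trans em ma.
have sib : ole (osucc i) b := ole_trans em mb.
have aia := absorbs_below_succ na sia; have aib := absorbs_below_succ nb sib.
have sab c : normal_bound c -> ole (osucc i) c -> absorbs (osucc i) c \/ ole c (osucc i).
  move=> nc ic; case: (ole_or_olt c (osucc i)) => [|h]; [by right|left].
  exact: absorbs_succ.
(* For [e = 0], which occurs when [b] is 2, [i] is 1 and not a normal bound. *)
have ni : oeq i (onat 1) \/ normal_bound i.
  case: (ole_or_olt (onat 1) e) => [e1|/olt_succ e0].
    by right; left; exists e => //; apply: oeq_refl.
  left; split; last exact: opow_ge1.
  exact: ole_trans (opow_mono e0) opow0_le.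
have ia : olt i a by apply: olt_ole_trans ma.
have i0 : olt ozero i := opow_gt0 e.
have [r1 [_ r2]] := pieces i ni (oltW ia) i0 (or_intror ia).
have nsi : normal_bound (osucc i) by right; exists e; apply: oeq_refl.
have abi u : olt u a -> olt u b -> ole u i.
  by move=> ua ub; apply/olt_succ; apply: olt_ole_trans me; apply: abm.
have E w S := iff_sym (@cut_inter_succ X w (sval F) (sval G) a b
    (@inprod X (sem P) w) (@inprod X Q w) (hP w) (hQ w) i S sia sib abi aia aib
    (sab a na sia) (sab b nb sib)).
have fin : rep (fun w => cut H (osucc i) (@inter P Q w)) (good (A :: P)) ->
    (absorbs (osucc i) a ->
      rep (fun w => cut H (osucc i) (@inter (A :: P) Q w)) (good (A :: P))) ->
    (absorbs (osucc i) b ->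
      rep (fun w => cut H (osucc i) (@inter P ((G, b) :: Q) w)) (good (A :: P))) ->
    rep (inter (A :: P) ((G, b) :: Q)) (good (A :: P)).
  move=> r3 r4 r5; apply: (rep_ext E).
  apply: rep_or r1 _; apply: rep_or (r2 aia) _; apply: rep_or r3 _.
  by apply: rep_or; apply: rep_and.
case: (pselect (~ sval F `<=` H \/ olt (osucc i) a)) => st.
  have [r5 [r3 r4]] := pieces (osucc i) (or_intror nsi) sia (normal_gt0 nsi) st.
  by right; apply: fin.
(* The exceptional case: [F] is included in [G] and [a] is [i + 1], so [H^{<i+1}] is the head
   [F^{<a}] itself. The pieces in which [a] or [b] absorbs [i + 1] cannot occur, and [P /\ Q] is
   lighter than [P] unless [P] is included in [Q], which gives containment. *)
have [/contrapT FH /oleNgt ai] : ~ ~ sval F `<=` H /\ ~ olt (osucc i) a.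
  by split=> h; apply: st; [left|right].
have FG' : sval F `<=` sval G by move=> y /FH[].
have ab : ole a b := ole_trans ai sib.
have HE (w : word X) K S : cut H (osucc i) K S <-> cut (sval F) a (K : set (wlen w) -> Prop) S.
  by split; apply: cut_mono.
case: (splits_lt (IHP Q nQ)) => [PQ|r].
  by left=> w S; apply: cut_mono => //; apply: PQ.
right; apply: fin.
- apply: rep_cut r _ => R hR; exists (A :: R); first by right; exists R.
  by move=> w S; rewrite HE.
- move=> h; case: (not_absorbs_succ i0).
  by apply: absorbs_oeq h; [apply: ole_refl|].
- move=> h; case: nabs; split=> //.
  by apply: absorbs_oeq h => //; apply: oeq_refl.
Qed.

Lemma product_splits P Q : normal Q -> splits P Q.
Proof.
elim: P Q => [|[C|F x] P IH]; [|exact: splits_letter|exact: splits_bounded].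
by move=> Q nQ; left=> w S; apply: inprod_empty.
Qed.

End Intersection.

(** * Words up to isomorphism *)

Lemma wo_irr (T : wellOrder) (x : T) : ~ wo_lt x x.
Proof. by elim/(well_founded_ind (@wo_wf T)): x => x IH h; exact: (IH x h h). Qed.

Lemma wo_homo_mono (T T' : wellOrder) (f : T -> T') :
  (forall x y, wo_lt x y -> wo_lt (f x) (f y)) ->
  forall x y, wo_lt (f x) (f y) -> wo_lt x y.
Proof.
move=> h x y fxy; case: (wo_total x y) => [//|[xy|/h yx]].
  by move: fxy; rewrite xy => /wo_irr.
by case: (wo_irr (wo_trans fxy yx)).
Qed.

Lemma wo_homo_inj (T T' : wellOrder) (f : T -> T') :
  (forall x y, wo_lt x y -> wo_lt (f x) (f y)) -> injective f.
Proof.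
move=> h x y fxy; case: (wo_total x y) => [/h|[//|/h]]; rewrite fxy => /wo_irr//.
Qed.

Section SubOrder.
Variables (T : wellOrder) (S : set T).

Let sub : Type := {x : T | S x}.
Let sub_lt (x y : sub) : Prop := wo_lt (sval x) (sval y).

Let sub_wf : well_founded sub_lt.
Proof. exact: Inverse_Image.wf_inverse_image (@wo_wf T). Qed.

Let sub_trans x y z : sub_lt x y -> sub_lt y z -> sub_lt x z.
Proof. exact: wo_trans. Qed.

Let sub_total x y : sub_lt x y \/ x = y \/ sub_lt y x.
Proof.
case: x y => [x xa] [y ya]; rewrite /sub_lt /=.
case: (wo_total x y) => [|[xy|]]; [by left| |by right; right].
by right; left; case: y / xy ya => ya; congr exist; apply: Prop_irrelevance.
Qed.

Definition suborder : wellOrder := WellOrder sub_wf sub_trans sub_total.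

End SubOrder.

Section Embedding.
Variable X : Type.
Implicit Types u v w : word X.

(** A word isomorphism from [u] to the subword of [w] on [S]. It connects abstract words and their
    concatenations with sets of positions of one fixed word. *)
Definition embeds u w (f : wlen u -> wlen w) (S : set (wlen w)) :=
  [/\ forall x y, wo_lt x y -> wo_lt (f x) (f y), forall x, S (f x),
      forall z, S z -> exists x, f x = z & forall x, wletter (f x) = wletter x].

Lemma embeds_otype u w f S : @embeds u w f S -> oeq (otype (wlen u)) (tp S).
Proof.
move=> [fm fS Sf _].
have h x : oeq (rank (@wo_wf (wlen u)) x) (pos S (f x)).
  elim/(well_founded_ind (@wo_wf (wlen u))): x => x IH; split.
    apply/rank_le => y yx; have [h _] := IH y yx.
    by apply: ole_olt_trans h _; apply: pos_lt => //; apply: fm.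
  apply/pos_le => y Sy; have [z <-] := Sf y Sy; move=> /(wo_homo_mono fm) zx.
  by have [_ h] := IH z zx; apply: ole_olt_trans h _; apply: rank_lt.
split; first by apply/ole_aboveP => x; apply: ole_olt_trans (h x).1 (tp_lt (fS x)).
by apply/tp_le => y Sy; have [z <-] := Sf y Sy; exists z; have [] := h z.
Qed.

Definition subword w (S : set (wlen w)) : word X :=
  Word (wlen := suborder S) (fun x => wletter (sval x)).

Lemma subword_embeds w (S : set (wlen w)) :
  @embeds (subword S) w (fun x => sval x) S.
Proof. by split=> // [[]//|z Sz]; exists (exist _ z Sz). Qed.

Lemma embeds_wcat u w f S u1 v1 : @embeds u w f S -> word_iso u (wcat u1 v1) ->
  exists D f1 f2, [/\ down D S, @embeds u1 w f1 D & @embeds v1 w f2 (S `\` D)].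
Proof.
move=> [fm fS Sf fl] [g [gm gs gl]].
have [h hK] := choice gs.
have hm x y : wo_lt x y -> wo_lt (h x) (h y) by move=> xy; apply/gm; rewrite !hK.
have gK : cancel g h.
  by move=> x; apply: (wo_homo_inj (fun x y => (gm x y).1)); rewrite hK.
pose k z := f (h z).
have km x y : wo_lt x y -> wo_lt (k x) (k y) by move/hm/fm.
have kl z : wletter (k z) = wletter z by rewrite /k fl -gl hK.
have kS z : S z -> exists x, k x = z.
  by move=> /Sf[x <-]; exists (g x); rewrite /k gK.
pose D : set (wlen w) := [set z | exists p, k (inl p) = z].
exists D, (fun p => k (inl p)), (fun q => k (inr q)); split.
- split=> [_ [p <-]|_ y [p <-] /kS[[q|q] <-] lt]; first exact: fS.
    by exists q.
  by have := wo_homo_mono km lt.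
- by split=> [x y xy|x|z [p <-]|x]; [exact: km|exists x|exists p|exact: kl].
- split=> [x y xy|x|z [/kS[[p|q] <-] nD]|x].
  + exact: km.
  + by split; [apply: fS|move=> [p /(wo_homo_inj km)]].
  + by case: nD; exists p.
  + by exists q.
  + exact: kl.
Qed.

Lemma embeds_cut u w f S D : @embeds u w f S -> down D S ->
  word_iso u (wcat (subword D) (subword (S `\` D))).
Proof.
move=> [fm fS Sf fl] dD; set v := wcat _ _.
pose val (y : wlen v) : wlen w := match y with inl p => sval p | inr q => sval q end.
have valm x y : wo_lt x y -> wo_lt (val x) (val y).
  case: x y => [[p Dp]|[p [Sp Dp]]] [[q Dq]|[q [Sq Dq]]] //= _.
  exact: down_lt dD Dp Sq Dq.
have valS y : S (val y) by case: y => [[p Dp]|[p []]//]; apply: (proj1 dD).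
have vall y : wletter (val y) = wletter y by case: y.
have valP x : exists y, val y = f x.
  case: (pselect (D (f x))) => Dx; first by exists (inl (exist _ _ Dx)).
  by exists (inr (exist (S `\` D) (f x) (conj (fS x) Dx))).
have [g gP] := choice valP; exists g; split=> [x y|z|x].
- split=> [xy|/valm]; first by apply: (wo_homo_mono valm); rewrite !gP; apply: fm.
  by rewrite !gP; apply: wo_homo_mono.
- have [x fx] := Sf _ (valS z); exists x.
  by apply: (wo_homo_inj valm); rewrite gP.
- by rewrite -vall gP.
Qed.

End Embedding.

(** The general embedding, rather than [S] being all of [w], is what the induction needs: the
    factors of [u] are words of their own, and only their images are sets of positions of [w]. *)
Lemma word_productP (X : topologicalType) (s : seq (closed_set X * ord)) u w f S :
  @embeds X u w f S -> word_product s u <-> inprod s S.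
Proof.
elim: s u f S => [|[F a] s IH] u f S e.
  have [fm fS Sf fl] := e; split=> /= h x; first by move=> /Sf[y _]; case: (h y).
  exact: h (fS x).
split=> [[u1 [v1 [ua uF vs iso]]]|[D [dD ta DF Ds]]].
  have [D [f1 [f2 [dD e1 e2]]]] := embeds_wcat e iso; exists D; split=> //=.
  - by have [_ h] := embeds_otype e1; apply: ole_olt_trans h ua.
  - by have [_ _ Df fl] := e1; move=> x /Df[y <-]; rewrite fl.
  - exact/(IH _ _ _ e2).
exists (subword D), (subword (S `\` D)); split.
- by have [h _] := embeds_otype (@subword_embeds _ w D); apply: ole_olt_trans h ta.
- by move=> [x Dx]; apply: DF.
- exact/(IH _ _ _ (@subword_embeds _ w (S `\` D))).
- exact: embeds_cut e dD.
Qed.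

(** Converse of [noetherian_closed_wf]. If a filter on [U] has no cluster point in [U], each point
    of [U] is avoided by a closed member. Any closed member meets [U], so intersecting it with one
    that avoids a common point gives a strictly smaller closed member, endlessly. *)
Lemma closed_wf_noetherian (Z : topologicalType) :
  well_founded (@closed_lt Z) -> noetherian Z.
Proof.
move=> wf U oU A pA AU; apply: contrapT => ncl.
have nb x : U x -> exists C : closed_set Z, A (sval C) /\ ~ sval C x.
  move=> Ux; have : ~ cluster A x by move=> h; apply: ncl; exists x.
  move=> /existsNP[B /existsNP[O /not_implyP[AB /not_implyP[]]]].
  rewrite nbhsE => -[V [oV Vx] VO] BO.
  have cV : closed (~` V) by apply: open_closedC.
  exists (exist _ (~` V) cV); split=> /=; last by apply.
  by apply: filterS AB => y By Vy; apply: BO; exists y; split=> //; apply: VO.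
suff h (C : closed_set Z) : ~ A (sval C).
  by apply: (h (exist _ setT closedT)); apply: filterT.
elim/(well_founded_ind wf): C => C IH AC.
have [x [Ux Cx]] := filter_ex (filterI AU AC).
have [E [AE nEx]] := nb x Ux.
pose CE : closed_set Z := exist _ (sval C `&` sval E) (closedI (svalP C) (svalP E)).
apply: (IH CE); last exact: filterI.
by split=> [y []//|/(_ x Cx)[]].
Qed.

(** * Closed sets of words *)

Section Words.
Variables (X : topologicalType) (hX : noetherian X) (L : wellOrder).
Local Notation W := (words X L).
Local Notation mu := (@mu X hX L).
Implicit Types (P R : seq (atom X L)) (Q : seq (closed_set X * ord)).

Definition wset Q : set W := [set w | @inprod X Q (word_of w) setT].

Definition wunion (Qs : seq (seq (closed_set X * ord))) : set W :=
  [set w | exists2 Q, List.In Q Qs & wset Q w].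

Definition punion (Rs : seq (seq (atom X L))) : set W :=
  [set w | exists2 R, List.In R Rs & wset (sem R) w].

Definition psi (Rs : seq (seq (atom X L))) : ord :=
  foldr (fun R m => onadd (opw (mu R)) m) ozero Rs.

Lemma wsetE Q : wset Q = [set w | word_product Q (word_of w)].
Proof.
apply/funext => w; apply/propext; apply: iff_sym.
by apply: (@word_productP X Q _ (word_of w) id); split=> // z _; exists z.
Qed.

Lemma closed_wset Q : closed (wset Q).
Proof.
rewrite wsetE -[X in closed X]setCK; apply: open_closedC.
set O := ~` _.
have SO : regular_subword_subbase O by exists Q.
exists [set O]; last by rewrite bigcup_set1.
by move=> _ ->; apply: finI_from1.
Qed.

(** A basic open neighbourhood of [w] outside [C] is a finite intersection of complements of
    products, that is, the complement of a finite union of products. *)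
Lemma closed_sep (C : set W) w : closed C -> ~ C w ->
  exists Qs, C `<=` wunion Qs /\ ~ wunion Qs w.
Proof.
move=> cC nCw; have [D' sD' DE] := closed_openC cC.
have : (~` C) w by [].
rewrite -DE => -[A DA Aw].
have [E sE EA] := sD' _ DA.
have AC : A `<=` ~` C by rewrite -DE => v Av; exists A.
have h (s : seq (set W)) : (forall B, B \in s -> regular_subword_subbase B) ->
    exists Qs, forall v, (forall B, B \in s -> B v) <-> ~ wunion Qs v.
  elim: s => [|B s IH] hs; first by exists [::] => v; split=> // _ [].
  have [|Qs hQs] := IH; first by move=> B' B's; apply: hs; rewrite inE B's orbT.
  have [Q BQ] := hs B (mem_head _ _); exists (Q :: Qs) => v; split.
    move=> h [Q' [<-|Q's] vQ']; first by have := h B (mem_head _ _); rewrite BQ -wsetE.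
    apply: (hQs v).1; last by exists Q'.
    by move=> B' B's; apply: h; rewrite inE B's orbT.
  move=> n B'; rewrite inE => /orP[/eqP->|].
    by rewrite BQ -wsetE => vQ; apply: n; exists Q => //; left.
  by move: B'; apply/hQs => -[Q' Q's vQ']; apply: n; exists Q' => //; right.
have [|Qs hQs] := h (enum_fset E); first by move=> B /sE; rewrite inE.
exists Qs; have EP v : A v <-> ~ wunion Qs v.
  rewrite -hQs -EA; split=> h' B; apply: h'.
split; last exact/EP.
by move=> v Cv; apply: contrapT => /EP/AC.
Qed.

Lemma wunion_normal Qs : exists2 Qs', (forall Q, List.In Q Qs' -> normal Q) &
  wunion Qs' = wunion Qs.
Proof.
elim: Qs => [|Q Qs [Qs' nQs' E]]; first by exists [::].
have split1 v : wunion (Q :: Qs) v <-> wset Q v \/ wunion Qs v.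
  split=> [[Q0 [<-|h] hv]|[h|[Q' Q's h]]]; [by left|by right; exists Q0| |].
    by exists Q => //; left.
  by exists Q' => //; right.
case: (norm_prod Q) => [nQ|[t nt ht]].
  exists Qs' => //; rewrite E; apply/funext => v; apply/propext; rewrite split1.
  by split=> [|[/nQ|]//]; right.
exists (t :: Qs') => [Q' [<-|/nQs']//|].
apply/funext => v; apply/propext; rewrite split1 -E.
split=> [[Q0 [<-|h] hv]|[h|[Q' Q's h]]].
- by left; apply/ht.
- by right; exists Q0.
- by exists t; [left|apply/ht].
- by exists Q' => //; right.
Qed.

(** Why weights are exponentiated in [psi]: any finite number of products lighter than [a] together
    count less than a single product of weight [a]. *)
Lemma psi_lt Rs a : (forall R, List.In R Rs -> olt (mu R) a) -> olt (psi Rs) (opw a).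
Proof.
elim: Rs => [_|R Rs IH h]; first exact: opow_gt0.
by apply: opow_onadd; [apply/opow_lt/h; left|apply: IH => R' hR; apply: h; right].
Qed.

Lemma psi_cat Rs Rs' : ole (psi (Rs ++ Rs')) (onadd (psi Rs) (psi Rs')).
Proof.
elim: Rs => [|R Rs IH]; first exact: (@ole_onaddl ozero).
apply: ole_trans (onadd_mono (ole_refl _) IH) (onaddA_le _ _ _).
Qed.

Lemma psi_mem Rs R : List.In R Rs -> ole (opw (mu R)) (psi Rs).
Proof.
elim: Rs => // R' Rs IH [->|/IH h]; first exact: ole_onaddr.
by apply: ole_trans h _; apply: ole_onaddl.
Qed.

Lemma punion_cat Rs Rs' v : punion (Rs ++ Rs') v <-> punion Rs v \/ punion Rs' v.
Proof.
split=> [[R /List.in_app_iff[h|h] hv]|[[R h hv]|[R h hv]]].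
- by left; exists R.
- by right; exists R.
- by exists R => //; apply/List.in_app_iff; left.
- by exists R => //; apply/List.in_app_iff; right.
Qed.

Lemma punion_cons R Rs v : punion (R :: Rs) v <-> wset (sem R) v \/ punion Rs v.
Proof.
split=> [[Q0 [<-|h] hv]|[h|[R' h hv]]].
- by left.
- by right; exists Q0.
- by exists R => //; left.
- by exists R' => //; right.
Qed.

Lemma product_wunion P Qs : (forall Q, List.In Q Qs -> normal Q) ->
  wset (sem P) `<=` wunion Qs \/ exists2 Rs, punion Rs = wset (sem P) `&` wunion Qs &
    forall R, List.In R Rs -> olt (mu R) (mu P).
Proof.
elim: Qs => [_|Q Qs IH nQs].
  right; exists [::] => //; apply/funext => v; apply/propext.
  by split=> [[]|[_ []]].
have [|h|[Rs ERs hRs]] := IH; first by move=> Q' h; apply: nQs; right.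
  by left=> v /h[Q' Q's vQ']; exists Q' => //; right.
have [h|[Rs' [ERs' hRs']]] := product_splits hX P (nQs Q (or_introl erefl)).
  by left=> v /h hv; exists Q => //; left.
right; exists (Rs' ++ Rs); last first.
  by move=> R /List.in_app_iff[/hRs'/good_mu|/hRs].
apply/funext => v; apply/propext; rewrite punion_cat ERs.
split=> [[/ERs'[h1 h2]|[h1 [Q' Q's h2]]]|[h1 [Q' [<-|Q's] h2]]].
- by split=> //; exists Q => //; left.
- by split=> //; exists Q' => //; right.
- by left; apply/ERs'.
- by right; split=> //; exists Q'.
Qed.

(** Products already included in the union [Qs] are kept, and each of the others is replaced by
    finitely many lighter ones. So [psi] drops as soon as one product is replaced. *)
Lemma punion_wunion Rs Qs : (forall Q, List.In Q Qs -> normal Q) ->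
  exists Rs', [/\ punion Rs' = punion Rs `&` wunion Qs, ole (psi Rs') (psi Rs) &
    punion Rs `<=` wunion Qs \/ olt (psi Rs') (psi Rs)].
Proof.
move=> nQs; elim: Rs => [|P Rs [Rs' [E le lt]]].
  exists [::]; split; [|exact: ole_refl|by left=> v []].
  by apply/funext => v; apply/propext; split=> [[]|[[]]].
have Ecap v : punion (P :: Rs) v /\ wunion Qs v <->
    (wset (sem P) v /\ wunion Qs v) \/ (punion Rs v /\ wunion Qs v).
  by rewrite punion_cons; tauto.
case: (product_wunion P nQs) => [h|[Rs0 E0 lt0]].
  exists (P :: Rs'); split.
  - apply/funext => v; apply/propext; apply: iff_trans (iff_sym (Ecap v)).
    rewrite punion_cons E; split=> -[h'|h']; [left|right|left; case: h'|right] => //.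
    by split=> //; apply: h.
  - by apply: onadd_mono => //; apply: ole_refl.
  - case: lt => [lt|lt]; last by right; apply: onadd_ltr.
    by left=> v /punion_cons[/h|/lt].
have lt1 : olt (psi (Rs0 ++ Rs')) (psi (P :: Rs)).
  apply: ole_olt_trans (psi_cat _ _) _.
  by apply: onadd_lt => //; apply: psi_lt.
exists (Rs0 ++ Rs'); split; [|exact: oltW|by right].
apply/funext => v; apply/propext; apply: iff_trans (iff_sym (Ecap v)).
by rewrite punion_cat E0 E.
Qed.

(** Arbitrary intersections are reached by descent. As long as [C] misses a point of the current
    union, [closed_sep] gives a union of products containing [C] and missing that point;
    intersecting with it lowers [psi], so the process stops, and it stops at [C]. *)
Lemma closed_repr Rs (C : set W) : closed C -> C `<=` punion Rs ->
  exists Rs', [/\ C = punion Rs', ole (psi Rs') (psi Rs) &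
    ~ punion Rs `<=` C -> olt (psi Rs') (psi Rs)].
Proof.
move=> cC; have [a] : exists a, a = psi Rs by eexists.
elim/(well_founded_ind olt_wf): a Rs => a IH Rs aE CRs.
case: (pselect (punion Rs `<=` C)) => [RsC|].
  exists Rs; split=> //; [exact/seteqP|exact: ole_refl].
move=> /existsNP[w /not_implyP[Rsw nCw]].
have [Qs0 [CQs nQsw]] := closed_sep cC nCw.
have [Qs nQs EQs] := wunion_normal Qs0; rewrite -EQs in CQs nQsw.
have [Rs1 [E1 _ [h|lt1]]] := punion_wunion Rs nQs; first by case: nQsw; apply: h.
have C1 : C `<=` punion Rs1 by rewrite E1 => v Cv; split; [apply: CRs|apply: CQs].
have [|Rs2 [E2 le2 _]] := IH (psi Rs1) _ Rs1 erefl C1; first by rewrite aE.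
have lt2 := ole_olt_trans le2 lt1.
by exists Rs2; split=> //; apply: oltW.
Qed.

End Words.

Section Ranks.
Variables (X : topologicalType) (hX : noetherian X) (L : wellOrder).
Hypothesis hL : proper_bound (otype L).
Local Notation W := (words X L).
Local Notation mu := (@mu X hX L).
Local Notation psi := (@psi X hX L).
Implicit Types (R : seq (atom X L)) (Rs : seq (seq (atom X L))).

Definition top : seq (atom X L) :=
  [:: Bounded (exist _ setT closedT)
        (exist (fun x : option L => proper_bound (below_otype x)) None hL)].

Lemma wset_top : wset (sem top) = [set: W].
Proof.
apply/seteqP; split=> // w _; exists setT; split=> //; last by move=> x [_]; apply.
have [_ h] : oeq (otype (segment (words_len w))) (tp [set: segment (words_len w)]).
  by apply: (@embeds_otype X (word_of w) (word_of w) id); split=> // z _; exists z.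
apply: ole_olt_trans h _; exists (words_len w); apply/ole_aboveP => x.
apply: ole_olt_trans (rank_lt (@wo_wf L) (svalP x)).
elim/(well_founded_ind (@wo_wf (segment (words_len w)))): x => x IH.
apply/rank_le => y yx; apply: ole_olt_trans (IH y yx) _; exact: rank_lt.
Qed.

Lemma punion1 R : punion [:: R] = wset (sem R) :> set W.
Proof.
by apply/funext => v; apply/propext; rewrite punion_cons; split=> [[|[]]//|]; left.
Qed.

Lemma top_repr (C : set W) : closed C ->
  exists2 Rs, C = punion Rs & ole (psi Rs) (psi [:: top]).
Proof.
move=> cC; have [|Rs [E le _]] := closed_repr hX (Rs := [:: top]) cC.
  by rewrite punion1 wset_top.
by exists Rs.
Qed.

Lemma words_closed_wf : well_founded (@closed_lt W).
Proof.
move=> C; have [Rs E _] := top_repr (svalP C).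
move: E; have [a] : exists a, a = psi Rs by eexists.
elim/(well_founded_ind olt_wf): a Rs C => a IH Rs C aE CE.
constructor=> D [DC CD]; rewrite CE in DC CD.
have [Rs' [E' _ lt]] := closed_repr hX (svalP D) DC.
by apply: (IH (psi Rs') _ Rs') => //; rewrite aE; apply: lt.
Qed.

Definition words_noetherian : noetherian W := closed_wf_noetherian words_closed_wf.

Lemma stature_le : ole (stature words_noetherian) (psi [:: top]).
Proof.
have h (C : closed_set W) Rs : sval C = punion Rs ->
    ole (rank (noetherian_closed_wf words_noetherian) C) (psi Rs).
  elim/(well_founded_ind words_closed_wf): C Rs => C IH Rs CE.
  apply/rank_le => D DC; have [DC1 DC2] := DC; rewrite CE in DC1 DC2.
  have [Rs' [E' _ lt]] := closed_repr hX (svalP D) DC1.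
  exact: ole_olt_trans (IH D DC Rs' E') (lt DC2).
by apply: h; rewrite punion1 wset_top.
Qed.

Lemma irreducible_punion (C : set W) Rs : irreducible_closed C -> C = punion Rs ->
  exists2 R, List.In R Rs & C = punion [:: R].
Proof.
move=> [cC C0 Cirr] CE.
have h Rs0 : C `<=` punion Rs0 -> exists2 R, List.In R Rs0 & C `<=` wset (sem R).
  elim: Rs0 => [CR|R Rs0 IH CR]; first by case: C0 => v /CR[].
  have cU : closed (punion Rs0).
    elim: Rs0 {IH CR} => [|R' Rs0 IH].
      have -> : punion [::] = set0 :> set W by apply/seteqP; split=> // v [].
      exact: closed0.
    have -> : punion (R' :: Rs0) = wset (sem R') `|` punion Rs0 :> set W.
      by apply/funext => v; apply/propext; rewrite punion_cons.
    by apply: closedU => //; apply: closed_wset.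
  case: (Cirr _ _ (@closed_wset _ _ (sem R)) cU) => [v /CR/punion_cons//|CR1|/IH[R' h CR']].
    by exists R => //; left.
  by exists R' => //; right.
have [|R hR CR] := h Rs; first by rewrite CE.
exists R => //.
rewrite punion1; apply/seteqP; split=> // v hv; rewrite CE; by exists R.
Qed.

(** A smaller irreducible closed set is one product [R'] of a union with smaller [psi]. Then
    [omega^(mu R')] is below [omega^(mu R)], and comparing exponents gives [mu R'] below [mu R]: one
    exponential is saved with respect to [stature_le]. *)
Lemma sober_rank_le (C : sobrification W) R : sval C = punion [:: R] ->
  ole (sober_rank words_noetherian C) (mu R).
Proof.
elim/(well_founded_ind (noetherian_sober_wf words_noetherian)): C R => C IH R CE.
apply/rank_le => D DC; have [DC1 DC2] := DC; rewrite CE in DC1 DC2.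
have cD : closed (sval D) by case: (svalP D).
have [Rs' [E' _ lt]] := closed_repr hX cD DC1.
have [R' R's DE] := irreducible_punion (svalP D) E'.
apply: ole_olt_trans (IH D DC R' DE) _; apply: opow_ltI.
apply: ole_olt_trans (psi_mem hX R's) _.
exact: olt_ole_trans (lt DC2) (onadd0r_le _).
Qed.

Lemma rsob_le : ole (rsob words_noetherian) (mu top).
Proof.
apply/ole_osup => -[C _] /=.
have cC : closed (sval C) by case: (svalP C).
have [Rs E le] := top_repr cC.
have [R Rin CE] := irreducible_punion (svalP C) E.
apply: ole_trans (sober_rank_le CE) _; apply: opow_leI.
apply: ole_trans (psi_mem hX Rin) (ole_trans le _); exact: onadd0r_le.
Qed.

Lemma mu_top : ole (mu top) (opw (ocirc (onadd (stature hX) (bracket hL)))).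
Proof. exact: onadd0r_le. Qed.

End Ranks.

Theorem proposition9p4 (X : topologicalType) (hX : noetherian X)
    (alpha : wellOrder) (halpha : proper_bound (otype alpha)) :
  exists hW : noetherian (words X alpha),
    ole (rsob hW)
        (opow omega (ocirc (onadd (stature hX) (bracket halpha)))) /\
    ole (stature hW)
        (opow omega (opow omega (ocirc (onadd (stature hX) (bracket halpha))))).
Proof.
exists (words_noetherian hX halpha); split.
  exact: ole_trans (rsob_le hX halpha) (mu_top hX halpha).
apply: ole_trans (stature_le hX halpha) (ole_trans (onadd0r_le _) _).
exact/opow_mono/mu_top.
Qed.
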